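(* Let $G$ be a group generated by a symmetric set $S$ and let $w\in F(S)$. Suppose there exist cyclically reduced words $v_i\in F(S)$ ($i\in\mathbb{N}$) such that $v_i=_G 1$ for each $i$; the closed path in $\mathrm{Cay}(G,S)$ starting at $1$ and labelled by $v_i$ is a quasi-isometric image of a cycle of length $|v_i|_S$ with constants independent of $i$, i.e. there are constants $\mu\ge 1$, $c\ge 0$ such that for every $i$ the natural label-preserving map from the cycle graph of length $|v_i|_S$ with label $v_i$ to $\mathrm{Cay}(G,S)$ is a $(\mu,c)$-quasi-isometric embedding; and $$\lim_{n\to\infty}\limsup_{i\to\infty}\left(\mathrm{sat}_{w^n}(v_i)\right)>0.$$ Then $w$ is not a generalized loxodromic element of $G$.
   Context: An action of a group $G$ by isometries on a metric space $X$ is acylindrical if for all $d\ge 0$ there exist constants $M,N\ge 0$ such that for all $x,y\in X$ with $d(x,y)\ge M$, the number of elements $g\in G$ satisfying $d(x,gx)\le d$ and $d(y,gy)\le d$ is at most $N$. An element $g\in G$ is generalized loxodromic if there is an acylindrical action of $G$ on a (Gromov) hyperbolic space $X$ such that $g$ acts loxodromically. $F(S)$ is the free group on $S$, whose elements are regarded as reduced words; $|v|_S$ is word length, $v=_G1$ means that $v$ represents the identity of $G$, and $w\in F(S)$ is also regarded as the element of $G$ it represents. $\mathrm{Cay}(G,S)$ is the Cayley graph with its path metric. Given words $v,w\in F(S)$ with $v$ cyclically reduced, the $w$-saturation of $v$ is $\mathrm{sat}_w(v)=k/|v|_S$, where $k$ is the largest number of letters in a cyclic conjugate of $v$ which can be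 covered by (not necessarily disjoint) copies of cyclically reduced conjugates of the word $w$. For example $\mathrm{sat}_a(a^3ba^4)=\mathrm{sat}_{a^4}(a^3ba^4)=7/8$ but $\mathrm{sat}_{a^8}(a^3ba^4)=0$.
   Formalization: The generating set S is additionally assumed finite; for infinite S the claim fails, e.g. for w = a in ⟨a, s_{i,j} (i≥1, 1≤j≤9i) | a^i s_{i,1}⋯s_{i,9i}⟩, a free group with a in a basis, with these relators as the v_i. *)

(* Defs.v *)
From HB Require Import structures.
From mathcomp Require Import all_boot all_order all_algebra.
From mathcomp Require Import all_classical all_reals all_analysis.

Set Implicit Arguments.
Unset Strict Implicit.
Unset Printing Implicit Defensive.

Import Order.TTheory GRing.Theory Num.Theory.
Import numFieldNormedType.Exports.

Local Open Scope classical_set_scope.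
Local Open Scope ring_scope.

(** * Free groups as groups of reduced words *)

Section FreeGroup.
Variable A : choiceType.

(* [(a, true)] is the letter a and [(a, false)] its formal inverse. *)
Definition letter : Type := (A * bool)%type.
HB.instance Definition _ := Choice.on letter.

Definition linv (l : letter) : letter := (l.1, ~~ l.2).

Definition compat (l l' : letter) : bool := l' != linv l.

Arguments compat : simpl never.

Definition reduced (u : seq letter) : bool := sorted compat u.

(* [cycle] also compares the last letter with the first one. *)
Definition cyclically_reduced (u : seq letter) : bool := cycle compat u.

Definition push (l : letter) (u : seq letter) : seq letter :=
  if u is l' :: u' then if compat l l' then l :: u else u' else [:: l].

Definition free_reduce (u : seq letter) : seq letter := foldr push [::] u.

Lemma linvK : involutive linv.
Proof. by case=> a b; rewrite /linv /= negbK. Qed.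

Lemma compat_linv l : compat l (linv l) = false.
Proof. by rewrite /compat eqxx. Qed.

Lemma compatN l l' : compat l l' = false -> l' = linv l.
Proof. by rewrite /compat => /negbFE/eqP. Qed.

Lemma push_reduced l u : reduced u -> reduced (push l u).
Proof.
case: u => //= l' u ru; case: ifP => [ll'|_] /=; first by rewrite ll'.
by rewrite /reduced; case: u ru => //= l'' u /andP[].
Qed.

Lemma pushK l u : reduced u -> push l (push (linv l) u) = u.
Proof.
case: u => [|l' u] /=; first by rewrite compat_linv.
case: ifP => [_ _|/compatN ->]; first by rewrite /= compat_linv.
rewrite linvK.
by rewrite /reduced; case: u => [|l'' u] //= /andP[->].
Qed.

Lemma foldr_push_reduced u v : reduced v -> reduced (foldr push v u).
Proof. by move=> rv; elim: u => //= l u; apply: push_reduced. Qed.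

Lemma free_reduce_reduced u : reduced (free_reduce u).
Proof. exact: foldr_push_reduced. Qed.

Lemma free_reduce_id u : reduced u -> free_reduce u = u.
Proof.
elim: u => //= l u IHu lu; rewrite /free_reduce /= -/(free_reduce u).
rewrite IHu; last by case: u lu {IHu} => //= l' u /andP[].
by rewrite /reduced in lu *; case: u lu {IHu} => //= l' u /andP[->].
Qed.

Lemma foldr_push_push l u v : reduced v ->
  foldr push v (push l u) = push l (foldr push v u).
Proof.
case: u => //= l' u rv; case: ifP => //= /compatN ->.
by rewrite pushK// foldr_push_reduced.
Qed.

Lemma foldr_push_free_reduce u v : reduced v ->
  foldr push v (free_reduce u) = foldr push v u.
Proof.
by move=> rv; elim: u => //= l u IHu; rewrite foldr_push_push// IHu.
Qed.

Lemma free_reduce_cat u v :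
  free_reduce (u ++ v) = foldr push (free_reduce v) u.
Proof. by rewrite /free_reduce foldr_cat. Qed.

Lemma free_reduce_catl u v :
  free_reduce (free_reduce u ++ v) = free_reduce (u ++ v).
Proof.
by rewrite !free_reduce_cat foldr_push_free_reduce// free_reduce_reduced.
Qed.

Lemma free_reduce_catr u v :
  free_reduce (u ++ free_reduce v) = free_reduce (u ++ v).
Proof.
by rewrite !free_reduce_cat free_reduce_id// free_reduce_reduced.
Qed.

Record free_group := FreeGroup {
  word_of :> seq letter;
  word_of_reduced : reduced word_of }.

HB.instance Definition _ := [isSub for word_of].
HB.instance Definition _ := [Choice of free_group by <:].

Definition free_of_word (u : seq letter) : free_group :=
  FreeGroup (free_reduce_reduced u).

Definition free_one : free_group := free_of_word [::].
Definition free_mul (u v : free_group) : free_group := free_of_word (u ++ v).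
Definition free_inv (u : free_group) : free_group :=
  free_of_word (rev (map linv u)).

Lemma free_mulA : associative free_mul.
Proof.
by move=> u v t; apply: val_inj; rewrite /= free_reduce_catl free_reduce_catr catA.
Qed.

Lemma free_mul1 : left_id free_one free_mul.
Proof.
by move=> u; apply: val_inj; rewrite /= free_reduce_id// word_of_reduced.
Qed.

Lemma free_mulr1 : right_id free_one free_mul.
Proof.
by move=> u; apply: val_inj; rewrite /= cats0 free_reduce_id// word_of_reduced.
Qed.

Lemma free_reduce_invl u : free_reduce (rev (map linv u) ++ u) = [::].
Proof.
elim: u => //= l u IHu; rewrite rev_cons cat_rcons free_reduce_cat.
have -> : free_reduce (linv l :: l :: u) = free_reduce u.
  by rewrite /= -[in push l _](linvK l) pushK// free_reduce_reduced.
by rewrite -free_reduce_cat.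
Qed.

Lemma free_mulV : left_inverse free_one free_inv free_mul.
Proof.
by move=> u; apply: val_inj; rewrite /= free_reduce_catl free_reduce_invl.
Qed.

Lemma free_mulrV : right_inverse free_one free_inv free_mul.
Proof.
move=> u; apply: val_inj; rewrite /= free_reduce_catr.
have := free_reduce_invl (rev (map linv u)).
by rewrite map_rev revK -map_comp (eq_map linvK) map_id.
Qed.

HB.instance Definition _ := isGroup.Build free_group
  free_mulA free_mul1 free_mulr1 free_mulV free_mulrV.

End FreeGroup.

(** * Metrics, graphs and quasi-isometric embeddings *)

Definition qi_embedding (R : realType) (T U : Type) (dT : T -> T -> R)
    (dU : U -> U -> R) (mu c : R) (f : T -> U) : Prop :=
  forall x y, mu^-1 * dT x y - c <= dU (f x) (f y) <= mu * dT x y + c.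

Fixpoint walk (V : Type) (E : V -> V -> Prop) (n : nat) (x y : V) : Prop :=
  if n is m.+1 then exists2 z, E x z & walk E m z y else x = y.

(* The path metric restricted to the vertices (junk value 0 between different
   components). Replacing a graph by its vertex set changes the constants of
   quasi-isometric embeddings between graphs by a bounded amount only. *)
Definition path_metric (R : realType) (V : Type) (E : V -> V -> Prop)
    (x y : V) : R :=
  inf [set n%:R | n in [set n | walk E n x y]].

Definition cycle_edge (n : nat) (i j : 'I_n) : Prop :=
  j = ordS i \/ i = ordS j.

Definition geodesic (R : realType) (X : metricType R) (x y : X)
    (p : R -> X) : Prop :=
  [/\ p 0 = x, p (mdist x y) = y &
    forall s t, 0 <= s <= mdist x y -> 0 <= t <= mdist x y ->
      mdist (p s) (p t) = `|s - t|].

Definition side (R : realType) (X : metricType R) (x y : X)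
    (p : R -> X) : set X := p @` `[0, mdist x y].

(* Geodesic metric spaces with uniformly slim triangles; the condition on one
   side of each triangle suffices, as geodesics can be reversed. *)
Definition hyperbolic (R : realType) (X : metricType R) : Prop :=
  (forall x y : X, exists p, geodesic x y p) /\
  exists delta : R, forall (x y z : X) (p q r : R -> X),
    geodesic x y p -> geodesic y z q -> geodesic x z r ->
    forall a, side x y p a ->
      exists2 b, (side y z q `|` side x z r) b & mdist a b <= delta.

(** * Generalized loxodromic elements *)

Definition isometric_action (R : realType) (G : groupType) (X : metricType R)
    (act : G -> X -> X) : Prop :=
  [/\ forall x, act 1%g x = x,
      forall g h x, act (g * h)%g x = act g (act h x) &
      forall g x y, mdist (act g x) (act g y) = mdist x y].

Definition acylindrical (R : realType) (G : groupType) (X : metricType R)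
    (act : G -> X -> X) : Prop :=
  forall d : R, 0 <= d -> exists (M : R) (N : nat), 0 <= M /\
    forall x y : X, M <= mdist x y ->
      ([set g | mdist x (act g x) <= d /\ mdist y (act g y) <= d]
         #<= `I_N)%card.

Definition expgz (G : groupType) (g : G) (n : int) : G :=
  match n with Posz m => (g ^+ m)%g | Negz m => (g ^- m.+1)%g end.

Definition loxodromic (R : realType) (G : groupType) (X : metricType R)
    (act : G -> X -> X) (g : G) : Prop :=
  exists (x : X) (mu c : R), [/\ 1 <= mu, 0 <= c &
    qi_embedding (fun m n : int => `|m - n|%:~R) (@mdist R X) mu c
      (fun n => act (expgz g n) x)].

Definition generalized_loxodromic (R : realType) (G : groupType)
    (g : G) : Prop :=
  exists (X : metricType R) (act : G -> X -> X),
    [/\ hyperbolic X, isometric_action act, acylindrical act &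
        loxodromic act g].

(** * Generating sets and Cayley graphs *)

(* The main theorem takes S finite (G finitely generated), as it fails for
   infinite S: let G be generated by a and the s_{i,j} for 1 <= i and
   1 <= j <= 9i, subject to the relators r_i = a^i s_{i,1} ... s_{i,9i}. Then G
   is free of infinite rank with a in a basis, so that a is generalized
   loxodromic, whereas the presentation is C'(1/6), so that the r_i label
   isometrically embedded cycles, and sat_{a^n}(r_i) = 1/10 for i >= n. *)
Definition symmetric_set (G : groupType) (S : set G) : Prop :=
  forall s, S s -> S s^-1%g.

Definition generates (G : groupType) (S : set G) : Prop :=
  forall H : set G, H 1%g -> (forall g h, H g -> H h -> H (g * h^-1)%g) ->
    S `<=` H -> H = setT.

(* The alphabet is S itself: the formal inverse of the letter s and the letter
   s^-1 are distinct letters with the same value in G. *)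
Definition letter_val (G : groupType) (S : set G) (l : letter S) : G :=
  if l.2 then val l.1 else (val l.1)^-1%g.

Definition word_val (G : groupType) (S : set G) (u : seq (letter S)) : G :=
  (\prod_(l <- u) letter_val l)%g.

Definition cayley_edge (G : groupType) (S : set G) (g h : G) : Prop :=
  exists2 s, S s & h = (g * s)%g.

Definition cayley_loop (G : groupType) (S : set G) (v : seq (letter S))
    (i : 'I_(size v)) : G := word_val (take i v).

(** * Saturation *)

(* Position [p] of the word [x] lies in a copy, as a subword of [x], of a
   cyclically reduced conjugate of [w]. *)
Definition covered (A : choiceType) (w : free_group A) (x : seq (letter A))
    (p : nat) : Prop :=
  exists (h : free_group A) (i : nat), let u := (w ^ h)%g in
    [/\ cyclically_reduced u, prefix u (drop i x) & (i <= p < i + size u)%N].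

(* Using all the available copies at once covers the largest number of letters
   of a given cyclic conjugate [rot j v]. *)
Definition max_covered (A : choiceType) (w v : free_group A) : nat :=
  (\max_(j < size v)
     #|[pred p : 'I_(size v) | `[< covered w (rot j v) p >]]|)%N.

(* The empty word has saturation 0 / 0 = 0. *)
Definition sat (R : realType) (A : choiceType) (w v : free_group A) : R :=
  (max_covered w v)%:R / (size v)%:R.

(* Main.v *)
Require Import Defs.
From HB Require Import structures.
From mathcomp Require Import all_boot all_order all_algebra.
From mathcomp Require Import all_classical all_reals all_analysis.
From mathcomp Require Import ring lra zify.

Set Implicit Arguments.
Unset Strict Implicit.
Unset Printing Implicit Defensive.

Import Order.TTheory GRing.Theory Num.Theory.
Import numFieldNormedType.Exports.

Local Open Scope classical_set_scope.
Local Open Scope ring_scope.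

(** Suppose that [w] acts loxodromically on a hyperbolic space [X], for an
    acylindrical action of [G], and let [x0] be a base point of [X]. The orbit
    map sends the loop labelled by [v i] to a closed path of [X], on which each
    copy of a cyclically reduced conjugate of [w ^+ n] is a quasi-geodesic, with
    constants that depend neither on [n] nor on the copy
    ([copy_quasigeodesic]). It is shown that, for any [kappa], the proportion
    of the loop covered by the copies is at most [244 / kappa] once [n] is
    large; hence the limit in the statement is not positive.

    Divide the loop into blocks of a large length [m], and replace each block
    by a geodesic of [X], which gives a polygon with about [size (v i) / m]
    sides. In a tree, a closed path crosses every edge equally often in both
    directions, and a polygon with [N] geodesic sides is glued from [O(N)]
    pairs of intervals, so that the sides that do not share an interval of
    length [H] with another one have total length [O(N * H)]. In the hyperbolic
    space [X] this is [polygon_marks]: mark points on the sides in such a way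
    that no two marks of a side are close to the same other side; then the
    number of marks is at most linear in [N]. The proof cuts the polygon along a
    chord orthogonal to a side at a marked point, and goes by induction
    on [N].

    On the other hand, no block deep inside a copy fellow-travels any other
    block for a long time ([deep_block_alone]). Indeed, acylindricity and the
    finiteness of [S] imply that the two blocks, if they did, would be close in
    the Cayley graph ([finite_fellows]); as the loop is quasi-isometrically
    embedded, they would be close in the loop, hence in the same copy, which is
    a quasi-geodesic. The point is the order of the choices: the length [H]
    of fellow-travelling that is excluded does not depend on [m]. So points at
    distance [H] of each other can be marked on the deep blocks; their number
    on each of these is [kappa] if [m] is large enough, as the blocks are
    quasi-geodesic. Therefore the deep blocks are at most a proportion
    [O(1 / kappa)] of all the blocks, and when [n] is large compared to [m] the
    deep blocks make up a definite part of what the copies cover. *)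

(** * Segments and slim triangles *)

Section Segments.
Variables (R : realType) (X : metricType R).
Implicit Types (x y z : X) (delta rho : R).

(** The points [z] of the geodesics from [x] to [y]. Using all of them at once
    frees the arguments from the choice of a geodesic. *)
Definition btw x y z : Prop := mdist x z + mdist z y = mdist x y.

Definition slim delta : Prop := forall x y z a, btw x y a ->
  exists2 b, btw x z b \/ btw y z b & mdist a b <= delta.

Definition near_seg rho x y z : Prop := exists2 b, btw x y b & mdist z b <= rho.

Definition isom_on (f : R -> X) (s t : R) : Prop := forall u v,
  s <= u <= t -> s <= v <= t -> mdist (f u) (f v) = `|u - v|.

Lemma btwC x y z : btw x y z -> btw y x z.
Proof.
by rewrite /btw (metric_sym y z) (metric_sym z x) (metric_sym y x) addrC.
Qed.

Lemma btw_l x y : btw x y x.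
Proof. by rewrite /btw mdistxx add0r. Qed.

Lemma btw_r x y : btw x y y.
Proof. by rewrite /btw mdistxx addr0. Qed.

Lemma btw_trans x y z u : btw x y z -> btw x z u -> btw x y u.
Proof.
rewrite /btw => xyz xuz.
by have := metric_triangle x u y; have := metric_triangle u z y; lra.
Qed.

Lemma near_segC rho x y z : near_seg rho x y z -> near_seg rho y x z.
Proof. by case=> b xyb zb; exists b => //; apply: btwC. Qed.

Lemma isom_btw f s t u v w : isom_on f s t -> s <= u -> u <= v -> v <= w ->
  w <= t -> btw (f u) (f w) (f v).
Proof.
move=> isf su uv vw wt; rewrite /btw !isf ?ler0_norm; lra.
Qed.

Lemma isom_onS f s t s' t' : s <= s' -> t' <= t -> isom_on f s t ->
  isom_on f s' t'.
Proof. by move=> ss tt isf u v ? ?; apply: isf; lra. Qed.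

(** A point of the segment [xy] lies on an honest geodesic: concatenate a
    geodesic from [x] to it with one from it to [y]. *)
Lemma hyperbolic_slim : hyperbolic X -> exists2 delta, 0 < delta & slim delta.
Proof.
case=> geod [delta thin]; exists (Num.max 1 delta).
  by rewrite lt_max ltr01.
move=> x y z a xya.
have [p1 [p10 p11 ip1]] := geod x a; have [p2 [p20 p21 ip2]] := geod a y.
have [q qg] := geod y z; have [r rg] := geod x z.
have xa0 := mdist_ge0 x a; have ay0 := mdist_ge0 a y.
pose p t := if t <= mdist x a then p1 t else p2 (t - mdist x a).
have pg : geodesic x y p.
  have pl u : 0 <= u <= mdist x a -> mdist (p u) a = mdist x a - u.
    move=> ub; rewrite /p ifT; last by lra.
    by rewrite -{1}p11 ip1; [rewrite distrC ger0_norm; lra|lra|lra].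
  have pl' u : 0 <= u <= mdist x a -> mdist x (p u) = u.
    move=> ub; rewrite /p ifT; last by lra.
    by rewrite -{1}p10 ip1; [rewrite distrC ger0_norm; lra|lra|lra].
  have pr u : mdist x a < u <= mdist x y -> mdist a (p u) = u - mdist x a.
    move=> ub; rewrite /p ifF; last by apply/negP; lra.
    rewrite -{1}p20 ip2; [rewrite distrC ger0_norm; lra|lra|].
    by rewrite /btw in xya; lra.
  have pr' u : mdist x a < u <= mdist x y -> mdist (p u) y = mdist x y - u.
    move=> ub; rewrite /p ifF; last by apply/negP; lra.
    rewrite -{1}p21 ip2; rewrite /btw in xya; [rewrite distrC ger0_norm|..]; lra.
  have p_lt s t : 0 <= s -> s <= t -> t <= mdist x y ->
      mdist (p s) (p t) = t - s.
    move=> s0 st ty; case: (lerP t (mdist x a)) => ta.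
      rewrite /p !ifT ?ip1 1?distrC ?ger0_norm; lra.
    case: (lerP s (mdist x a)) => sa; last first.
      rewrite /p !ifF ?ip2; rewrite /btw in xya;
        rewrite 1?distrC ?ger0_norm; try lra; apply/negP; lra.
    apply/eqP; rewrite eq_le.
    have := metric_triangle (p s) a (p t); rewrite pl ?pr; try lra.
    have := metric_triangle x (p s) y; have := metric_triangle (p s) (p t) y.
    rewrite pl' ?(pr' t); lra.
  split=> [||s t sb tb].
  - by rewrite /p xa0.
  - have [ya|ya] := lerP (mdist x y) (mdist x a); last first.
      rewrite /p ifF; last by apply/negP; lra.
      by rewrite /btw in xya; rewrite -xya addrC addKr.
    rewrite /p ya; rewrite /btw in xya.
    have /mdist_positivity ay : mdist a y = 0 by lra.
    by rewrite -ay.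
  - case: (lerP s t) => st; first by rewrite p_lt; lra.
    by rewrite metric_sym p_lt; lra.
have [] := thin x y z p q r pg qg rg a.
  exists (mdist x a); last by rewrite /p lexx.
  by rewrite /= in_itv /=; rewrite /btw in xya; lra.
have sidebtw u v (g : R -> X) b : geodesic u v g -> side u v g b -> btw u v b.
  case=> g0 g1 ig [t]; rewrite /= in_itv /= => tb <-; rewrite /btw.
  have -> : mdist u (g t) = t by rewrite -{1}[u]g0 ig ?ler0_norm; lra.
  by rewrite -[X in mdist _ X]g1 ig ?ler0_norm; lra.
move=> b [/(sidebtw _ _ _ _ qg) bs|/(sidebtw _ _ _ _ rg) bs] ab.
  by exists b; [right|rewrite le_max ab orbT].
by exists b; [left|rewrite le_max ab orbT].
Qed.

End Segments.

Section SlimTriangles.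
Variables (R : realType) (X : metricType R) (delta : R).
Hypotheses (delta_gt0 : 0 < delta) (slimX : slim X delta).
Implicit Types (p q x y z : X) (rho : R).

(** The ends [c] and [d] need not lie on a common geodesic from [x] to [y];
    the triangle [x c d] has two sides inside the segment [xy]. *)
Lemma near_seg_convex x y c d z : btw x y c -> btw x y d -> btw c d z ->
  near_seg delta x y z.
Proof.
move=> xyc xyd cdz; have [b [cxb|dxb] zb] := slimX x cdz; exists b => //.
  exact/(btw_trans xyc)/btwC.
exact/(btw_trans xyd)/btwC.
Qed.

(** In a tree, the hypothesis says that [p] is the projection of [q] to the
    segment [xy], so that the geodesics from [q] to [x] and to [y] pass
    through [p]. Contrary to a projection, a solution [q] of this equation
    is found on any path from [x] to [y] by continuity. *)
Lemma level_dist x y p q : btw x y p ->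
  mdist q x - mdist q y = mdist p x - mdist p y ->
  mdist q p + mdist p x - 2 * delta <= mdist q x /\
  mdist q p + mdist p y - 2 * delta <= mdist q y.
Proof.
move=> xyp lev.
suff [h|h] : mdist q p + mdist p x - 2 * delta <= mdist q x \/
  mdist q p + mdist p y - 2 * delta <= mdist q y; try by split; lra.
have [b [bs|bs] pb] := slimX q xyp; [left|right]; rewrite /btw in bs.
  have := metric_triangle q b p; have := metric_triangle p b x.
  rewrite (metric_sym b p) (metric_sym b x) (metric_sym q b) (metric_sym q x).
  lra.
have := metric_triangle q b p; have := metric_triangle p b y.
rewrite (metric_sym b p) (metric_sym b y) (metric_sym q b) (metric_sym q y).
lra.
Qed.

(** A point close to [p q0] inherits the property of [q0] that the geodesic
    to [x] passes by [p]. *)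
Lemma near_level_dist x p q0 q :
  mdist q0 p + mdist p x - 2 * delta <= mdist q0 x ->
  near_seg (4 * delta) p q0 q ->
  mdist q p + mdist p x - 10 * delta <= mdist q x.
Proof.
move=> lev [b]; rewrite /btw => pqb qb.
have := metric_triangle q0 b x; have := metric_triangle b q x.
have := metric_triangle q b p.
rewrite (metric_sym b q) (metric_sym q0 b) (metric_sym b p).
rewrite (metric_sym q0 p) in lev; lra.
Qed.

(** The segment [pq] leaves [p] orthogonally to [xy], so that the points of
    [xy] far from [p] are not close to it. *)
Lemma orthogonal_dist x p q0 q p' :
  mdist q0 p + mdist p x - 2 * delta <= mdist q0 x ->
  near_seg (4 * delta) p q0 q -> near_seg (3 * delta) p q p' ->
  mdist p x - 14 * delta <= mdist p' x.
Proof.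
have d0 := delta_gt0.
move=> lev [y' pqy qy] [z pqz pz].
suff [z' pqz' pz'] : near_seg (12 * delta) p q0 p'.
  rewrite /btw in pqz'; have := metric_triangle q0 z' x; have := mdist_ge0 p z'.
  have := metric_triangle z' p' x.
  rewrite (metric_sym q0 z') (metric_sym z' p').
  rewrite (metric_sym q0 p) in lev; lra.
have := slimX y' pqz => -[b [pb|qb] zb].
  exists b; first exact: btw_trans pqy pb.
  by have := metric_triangle p' z b; lra.
exists y' => //; rewrite /btw in qb.
have := metric_triangle p' z y'; have := metric_triangle z b y'.
have := mdist_ge0 q b; lra.
Qed.

(** The point of a geodesic from [q] to [y] at the distance of [p] from [q]
    is close to [p], because the triangle inequality at [p] is almost an
    equality. *)
Lemma near_of_defect p q y :
  mdist q p + mdist p y - 10 * delta <= mdist q y ->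
  (exists g : R -> X, geodesic q y g) ->
  near_seg (12 * delta) q y p.
Proof.
have d0 := delta_gt0.
move=> def [g [g0 g1 ig]].
case: (lerP (mdist q y) (mdist q p)) => qy.
  by exists y; [exact: btw_r|lra].
have qp0 := mdist_ge0 q p.
pose m := g (mdist q p).
have qm : mdist q m = mdist q p.
  by rewrite -{1}g0 ig ?ler0_norm; lra.
have my : mdist m y = mdist q y - mdist q p.
  by rewrite -{1}g1 ig ?ler0_norm; lra.
exists m; first by rewrite /btw qm my; lra.
have qym : btw q y m by rewrite /btw qm my; lra.
have [b [qb|yb] mb] := slimX p qym.
  rewrite /btw in qb.
  have := metric_triangle q b m; have := metric_triangle p b m.
  rewrite (metric_sym b m) (metric_sym p b); lra.
rewrite /btw in yb.
have := metric_triangle y b m; have := metric_triangle p b m.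
rewrite (metric_sym b m) (metric_sym p b) (metric_sym y m).
rewrite (metric_sym y p) in yb; lra.
Qed.

(** A point of [A] near [pq] but away from [q] would be near [p q0] as well,
    and closer to [p] than [q] is. *)
Lemma near_closest p q0 q z (A : X -> Prop) :
  near_seg (4 * delta) p q0 q ->
  (forall a, A a -> near_seg (4 * delta) p q0 a ->
     mdist p q <= mdist p a + delta) ->
  A z -> near_seg (3 * delta) p q z -> mdist z q <= 8 * delta.
Proof.
have d0 := delta_gt0.
move=> [y' pqy qy] qmin Az [w pqw zw].
have := slimX y' pqw => -[b [pb|qb] wb]; last first.
  rewrite /btw in qb.
  have := metric_triangle w b q; have := metric_triangle z w q.
  by rewrite (metric_sym b q); have := mdist_ge0 b y'; lra.
have /qmin : near_seg (4 * delta) p q0 z.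
  exists b; first exact: btw_trans pqy pb.
  by have := metric_triangle z w b; lra.
move=> /(_ Az); rewrite /btw in pqw.
have := metric_triangle p w z; have := metric_triangle z w q.
by rewrite (metric_sym w z); lra.
Qed.

(** Quasi-convexity resets the constants: if the ends are near [xy], for a
    large constant, then the middle is near it for a small constant. *)
Lemma near_seg_middle x y a b c : btw a b c ->
  15 * delta < mdist a c -> 15 * delta < mdist c b ->
  near_seg (13 * delta) x y a -> near_seg (13 * delta) x y b ->
  near_seg (3 * delta) x y c.
Proof.
have d0 := delta_gt0.
move=> abc ac cb [a' xya aa] [b' xyb bb].
have [w [aw|bw] cw] := slimX b' abc; last first.
  rewrite /btw in bw.
  have := metric_triangle c w b; rewrite (metric_sym w b).
  by have := mdist_ge0 w b'; lra.
have := slimX a' aw => -[u [au|bu] wu].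
  rewrite /btw in au.
  have := metric_triangle a u c; have := metric_triangle u w c.
  rewrite (metric_sym w c) (metric_sym u w).
  by have := mdist_ge0 u a'; lra.
have [v xyv uv] := near_seg_convex xyb xya bu.
exists v => //.
by have := metric_triangle c w v; have := metric_triangle w u v; lra.
Qed.

Lemma near_seg_side rho x y z q : btw x y q -> forall p,
  near_seg rho z q p ->
  near_seg (rho + delta) z x p \/ near_seg (rho + delta) x y p.
Proof.
move=> xyq p [b zqb pb]; have [c [zc|qc] bc] := slimX x zqb.
  left; exists c => //; have := metric_triangle p b c; lra.
right; exists c; first exact/(btw_trans xyq)/btwC.
by have := metric_triangle p b c; lra.
Qed.

End SlimTriangles.

(** * Polygons with marked sides *)

(** The supremum of the points where [h] is at least [v] is a solution. *)
Lemma lipschitz_ivt (R : realType) (h : R -> R) (C s t v : R) :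
  0 < C -> s <= t ->
  (forall x y, s <= x <= t -> s <= y <= t -> `|h x - h y| <= C * `|x - y|) ->
  h t <= v <= h s -> exists2 u, s <= u <= t & h u = v.
Proof.
move=> C0 st lip /andP[tv vs].
pose E := [set u | s <= u <= t /\ v <= h u].
have Es : E s by split=> //; lra.
have ubE : ubound E t by move=> u [/andP[]].
have hsE : has_sup E by split; [exists s|exists t].
have cs : s <= sup E by apply: ub_le_sup => //; exists t.
have ct : sup E <= t by apply: ge_sup => //; exists s.
have cst : s <= sup E <= t by rewrite cs.
exists (sup E) => //; apply/eqP; rewrite eq_le; apply/andP; split; rewrite leNgt.
- apply/negP => vc.
  have g0 : 0 < (h (sup E) - v) / C by rewrite divr_gt0; lra.
  pose u := Num.min t (sup E + (h (sup E) - v) / C).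
  have cu : sup E <= u by rewrite le_min ct; lra.
  have ust : s <= u <= t by rewrite (le_trans cs cu) ge_min lexx.
  have uc : u - sup E <= (h (sup E) - v) / C.
    by rewrite lerBlDl ge_min lexx orbT.
  have Cu : C * (u - sup E) <= h (sup E) - v.
    by rewrite mulrC -ler_pdivlMr.
  have Eu : E u.
    split=> //; have := lip _ _ ust cst; rewrite [X in C * X]ger0_norm; last by lra.
    by have := ler_norm (h (sup E) - h u); rewrite distrC; lra.
  have uE : u <= sup E by apply: ub_le_sup => //; exists t.
  move: uE; rewrite leNgt => /negP; apply; rewrite lt_min; apply/andP; split; last by lra.
  rewrite lt_neqAle ct andbT; apply/negP => /eqP ce; move: vc; rewrite ce; lra.
- apply/negP => vc.
  have g0 : 0 < (v - h (sup E)) / C by rewrite divr_gt0; lra.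
  have [u [ust vu] cu] := sup_adherent g0 hsE.
  have uc : u <= sup E by apply: ub_le_sup => //; exists t.
  have : sup E - u < (v - h (sup E)) / C by lra.
  rewrite ltr_pdivlMr// mulrC => Cu.
  have := lip _ _ cst ust; rewrite [X in C * X]ger0_norm; last by lra.
  by have := ler_norm (h u - h (sup E)); rewrite distrC; lra.
Qed.

Section Polygons.
Variables (R : realType) (X : metricType R).

(** A side of a polygon: the geodesic [geo], on the interval from [lo] to
    [hi], with marked positions. The sides are cut into pieces, which is why
    the interval does not start at 0. *)
Record side := Side { geo : R -> X; lo : R; hi : R; marks : seq R }.

Definition src (a : side) := geo a (lo a).
Definition tgt (a : side) := geo a (hi a).

Definition restr (a : side) (u v : R) (P : pred R) :=
  Side (geo a) u v [seq w <- marks a | P w].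

Definition valid_side (H : R) (a : side) : Prop :=
  [/\ lo a <= hi a, isom_on (geo a) (lo a) (hi a),
      pairwise (fun u v => u + H <= v) (marks a) &
      all (fun u => lo a <= u <= hi a) (marks a)].

Definition lonely (rho : R) (a b : side) : Prop := forall u v,
  u \in marks a -> v \in marks a ->
  near_seg rho (src b) (tgt b) (geo a u) ->
  near_seg rho (src b) (tgt b) (geo a v) -> u = v.

Definition apart (rho : R) (a b : side) : bool :=
  `[< lonely rho a b /\ lonely rho b a >].

Fixpoint chain (x : X) (P : seq side) (y : X) : Prop :=
  if P is a :: P' then src a = x /\ chain (tgt a) P' y else x = y.

Definition polygon (H rho : R) (P : seq side) : Prop :=
  [/\ exists x, chain x P x, all (fun a => `[< valid_side H a >]) P &
      pairwise (apart rho) P].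

Definition nmarks (P : seq side) : nat := sumn [seq size (marks a) | a <- P].

Lemma chain_cat x P Q z :
  chain x (P ++ Q) z <-> exists2 y, chain x P y & chain y Q z.
Proof.
elim: P x => [|a P IHP] x /=.
  by split=> [|[y ->]//]; exists x.
split=> [[-> /IHP[y Py Qy]]|[y [ax Py] Qy]]; first by exists y.
by split=> //; apply/IHP; exists y.
Qed.

Lemma apartC rho a b : apart rho a b = apart rho b a.
Proof. by apply/asboolP/asboolP => -[]. Qed.

Lemma polygon_rot H rho P Q : polygon H rho (P ++ Q) -> polygon H rho (Q ++ P).
Proof.
case=> -[x /chain_cat[y Py Qy]]; rewrite all_cat => /andP[vP vQ].
rewrite pairwise_cat => /and3P[PQ wP wQ]; split.
- by exists y; apply/chain_cat; exists x.
- by rewrite all_cat vP vQ.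
- rewrite pairwise_cat wP wQ andbT allrelC.
  by rewrite (@eq_allrel _ _ _ (apart rho)) ?PQ// => a b; apply: apartC.
Qed.

Lemma nmarks_cat P Q : nmarks (P ++ Q) = (nmarks P + nmarks Q)%N.
Proof. by rewrite /nmarks map_cat sumn_cat. Qed.

Lemma nmarks_cons a P : nmarks (a :: P) = (size (marks a) + nmarks P)%N.
Proof. by []. Qed.

Lemma all_split T (f : pred T) s :
  (forall s1 c s2, s = s1 ++ c :: s2 -> f c) -> all f s.
Proof.
elim: s => //= c s IHs fs; apply/andP; split; first exact: (fs [::] c s).
by apply: IHs => s1 d s2 e; apply: (fs (c :: s1) d s2); rewrite e.
Qed.

Lemma pairwise_gap (H : R) s u v : pairwise (fun u v => u + H <= v) s ->
  u \in s -> v \in s -> u != v -> H <= `|u - v|.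
Proof.
elim: s => //= w s IHs /andP[/allP ws ps]; rewrite !inE.
move=> /orP[/eqP ->|us] /orP[/eqP ->|vs]; first by rewrite eqxx.
- by move=> _; have := ws _ vs; have := ler_norm (v - w); rewrite distrC; lra.
- by move=> _; have := ws _ us; have := ler_norm (u - w); lra.
- exact: IHs.
Qed.

Lemma marks_bounds H a u : valid_side H a -> u \in marks a ->
  lo a <= u <= hi a.
Proof. by case=> _ _ _ /allP; apply. Qed.

Lemma marks_gap H a u v : valid_side H a -> u \in marks a -> v \in marks a ->
  u != v -> H <= mdist (geo a u) (geo a v).
Proof.
move=> va ua va' uv; have [_ isa pa _] := va.
rewrite isa ?(marks_bounds va)//.
exact: pairwise_gap pa _ _ _.
Qed.

Lemma restr_valid H a u v (P : pred R) : valid_side H a ->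
  lo a <= u -> u <= v -> v <= hi a ->
  (forall w, lo a <= w <= hi a -> P w -> u <= w <= v) ->
  valid_side H (restr a u v P).
Proof.
case=> _ isa pa ba au uv va Pw; split=> //=.
- exact: isom_onS isa.
- exact: pairwise_filter.
- apply/allP => w; rewrite mem_filter => /andP[Pw' wa].
  by apply: Pw => //; move/allP: ba; apply.
Qed.

Lemma lonely_restr_l rho a b u v P :
  lonely rho a b -> lonely rho (restr a u v P) b.
Proof.
by move=> lab w w'; rewrite !mem_filter => /andP[_ wa] /andP[_ wa']; apply: lab.
Qed.

Lemma btw_restr H a u v z : valid_side H a ->
  lo a <= u -> u <= v -> v <= hi a ->
  btw (geo a u) (geo a v) z -> btw (src a) (tgt a) z.
Proof.
case=> _ isa _ _ au uv va uvz.
have lv : btw (geo a (lo a)) (geo a v) (geo a u).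
  by apply: (isom_btw isa); lra.
apply: (@btw_trans _ _ _ _ (geo a v)); first by apply: (isom_btw isa); lra.
exact/btwC/(btw_trans (btwC lv))/btwC.
Qed.

Lemma lonely_restr_r H rho a b u v P : valid_side H b ->
  lo b <= u -> u <= v -> v <= hi b ->
  lonely rho a b -> lonely rho a (restr b u v P).
Proof.
move=> vb bu uv bv lab w w' wa wa' [c bc wc] [c' bc' wc'].
by apply: lab => //; [exists c|exists c'] => //; apply: (btw_restr vb) uv _ _.
Qed.

Lemma apart_restr H rho a b u v P : valid_side H a ->
  lo a <= u -> u <= v -> v <= hi a ->
  apart rho a b -> apart rho (restr a u v P) b.
Proof.
move=> va au uv av /asboolP[ab ba]; apply/asboolP; split.
  exact: lonely_restr_l.
exact: (lonely_restr_r va).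
Qed.

Lemma lonely_nil rho a b : marks a = [::] -> lonely rho a b.
Proof. by move=> a0 u v; rewrite a0. Qed.

End Polygons.

(** * Cutting a polygon along a chord *)

Section CutPolygons.
Variables (R : realType) (X : metricType R) (delta H : R).
Hypotheses (delta_gt0 : 0 < delta) (slimX : slim X delta).
Hypotheses (geodX : forall x y : X, exists p, geodesic x y p).
Hypothesis (H_large : 20 * delta <= H).
Implicit Types (a b : side X) (P Q : seq (side X)).

Let near13 a b u : bool :=
  `[< near_seg (13 * delta) (src b) (tgt b) (geo a u) >].

(** The function [phi] passes from above [v] to below it along the chain,
    hence takes the value [v] on one of the sides. *)
Lemma chain_level (phi : X -> R) y Q x v :
  (forall z z', `|phi z - phi z'| <= 2 * mdist z z') ->
  chain y Q x -> all (fun a => `[< valid_side H a >]) Q -> (0 < size Q)%N ->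
  phi x <= v <= phi y ->
  exists Q1 e Q2 u,
    [/\ Q = Q1 ++ e :: Q2, lo e <= u <= hi e & phi (geo e u) = v].
Proof.
move=> lip; elim: Q y => //= e Q IHQ y [ey eQ] /andP[/asboolP ve vQ] _ xvy.
case: (lerP (phi (tgt e)) v) => ev.
  have [leh ise _ _] := ve.
  have [|||u ue uv] := @lipschitz_ivt R (phi \o geo e) 2 (lo e) (hi e) v _ leh.
  - by [].
  - by move=> w w' we we' /=; rewrite -(ise w w').
  - by rewrite /= -/(tgt e) ev -/(src e) ey /=; case/andP: xvy.
  by exists [::], e, Q, u.
have [||Q1 [f [Q2 [u [-> ue uv]]]]] := IHQ _ eQ vQ.
- by case: Q eQ {IHQ vQ} => //= ex; move: ev xvy; rewrite ex; lra.
- by case/andP: xvy => -> _; rewrite ltW.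
by exists (e :: Q1), f, Q2, u.
Qed.

(** With four marks of [a] near [b], the two middle ones would be near [b]
    for the smaller constant, by quasi-convexity. *)
Lemma count_near a b : valid_side H a -> lonely (3 * delta) a b ->
  (count (near13 a b) (marks a) <= 3)%N.
Proof.
have d0 := delta_gt0; have Hl := H_large.
move=> va lab; rewrite -size_filter leqNgt; apply/negP.
case E : [seq _ <- _ | _] => [|u1 [|u2 [|u3 [|u4 s]]]] //= _.
have mem u : u \in [:: u1, u2, u3, u4 & s] ->
    near13 a b u /\ u \in marks a.
  by rewrite -E mem_filter => /andP[].
have [_ isa pa _] := va.
have : pairwise (fun u v => u + H <= v) [:: u1, u2, u3, u4 & s].
  by rewrite -E pairwise_filter.
rewrite /= => /andP[/and4P[u12 u13 u14 _]] /andP[/and3P[u23 u24 _]].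
move=> /andP[/andP[u34 _] _].
have [/asboolP n1 m1] := mem u1 (mem_head _ _).
have [_ m2] : near13 a b u2 /\ u2 \in marks a.
  by apply: mem; rewrite !inE eqxx ?orbT.
have [_ m3] : near13 a b u3 /\ u3 \in marks a.
  by apply: mem; rewrite !inE eqxx ?orbT.
have [/asboolP n4 m4] : near13 a b u4 /\ u4 \in marks a.
  by apply: mem; rewrite !inE eqxx ?orbT.
have b1 := marks_bounds va m1; have b2 := marks_bounds va m2.
have b3 := marks_bounds va m3; have b4 := marks_bounds va m4.
have mid u : u1 + H <= u -> u + H <= u4 -> lo a <= u <= hi a ->
    near_seg (3 * delta) (src b) (tgt b) (geo a u).
  move=> u1u uu4 bu.
  apply: (near_seg_middle delta_gt0 slimX _ _ _ n1 n4).
  - by apply: (isom_btw isa); lra.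
  - by rewrite isa// ler0_norm; lra.
  - by rewrite isa// ler0_norm; lra.
have := lab _ _ m2 m3 (mid _ u12 u24 b2) (mid _ u13 u34 b3).
by lra.
Qed.

Lemma mark_away a (B : seq (side X)) : valid_side H a ->
  all (fun b => `[< lonely (3 * delta) a b >]) B ->
  (3 * size B < size (marks a))%N ->
  exists2 u, u \in marks a & all (fun b =>
    ~~ `[< near_seg (13 * delta) (src b) (tgt b) (geo a u) >]) B.
Proof.
move=> va lB sB.
pose bad u := has (fun b => near13 a b u) B.
have cbad : (count bad (marks a) <= 3 * size B)%N.
  rewrite /bad; elim: B lB {sB bad} => [_|b B IHB] /=.
    by rewrite (@eq_count _ _ pred0)// count_pred0.
  move=> /andP[/asboolP lb /IHB cB].
  apply: (@leq_trans (count (near13 a b) (marks a) +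
      count (fun u => has (fun b => near13 a b u) B) (marks a))).
    by rewrite -count_predUI leq_addr.
  by rewrite mulnS leq_add// count_near.
have : has (predC bad) (marks a).
  rewrite has_count -(ltn_add2l (count bad (marks a))) addn0 count_predC.
  exact: leq_ltn_trans sB.
by case/hasP => u ua /= nb; exists u => //; rewrite all_predC.
Qed.

(** A chain [c] of at most one side followed by a part of the side [e] is a
    path with at most two sides, to which the segment joining its ends [x] and
    [geo e u] is close. *)
Lemma near_side_short x c e u (p : X) : chain x c (src e) -> (size c < 2)%N ->
  valid_side H e -> lo e <= u <= hi e ->
  near_seg (12 * delta) (geo e u) x p ->
  exists2 i, (i <= size c)%N &
    near_seg (13 * delta) (src (nth e c i)) (tgt (nth e c i)) p.
Proof.
have d0 := delta_gt0; have d13 : 12 * delta + delta = 13 * delta by ring.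
move=> xc c2 ve ue nu; have [_ ise _ _] := ve.
have eu : btw (src e) (tgt e) (geo e u) by apply: (isom_btw ise); lra.
case: c xc c2 => [|b [|//]] /=.
  move=> xe _; exists 0%N => //=; case: nu => z uxz pz; exists z; last by lra.
  by apply: (btw_trans eu); apply: btwC; rewrite -xe.
case=> bx be _; have := near_seg_side slimX eu (near_segC nu).
rewrite d13 -be => -[nb|ne].
  by exists 0%N => //=; rewrite bx.
by exists 1%N => //=; rewrite -be.
Qed.

Lemma near_side_short_rev x c e u (p : X) : chain (tgt e) c x ->
  (size c < 2)%N ->
  valid_side H e -> lo e <= u <= hi e ->
  near_seg (12 * delta) (geo e u) x p ->
  exists2 i, (i <= size c)%N &
    near_seg (13 * delta) (src (nth e (e :: c) i)) (tgt (nth e (e :: c) i)) p.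
Proof.
have d0 := delta_gt0; have d13 : 12 * delta + delta = 13 * delta by ring.
move=> xc c2 ve ue nu; have [_ ise _ _] := ve.
have eu : btw (src e) (tgt e) (geo e u) by apply: (isom_btw ise); lra.
case: c xc c2 => [|b [|//]] /=.
  move=> xe _; exists 0%N => //=; case: nu => z uxz pz; exists z; last by lra.
  by apply/btwC/(btw_trans (btwC eu))/btwC; rewrite xe.
case=> be bx _; have := near_seg_side slimX (btwC eu) (near_segC nu).
rewrite d13 => -[nb|ne].
  by exists 1%N => //=; rewrite be bx; apply: near_segC.
by exists 0%N => //=; apply: near_segC.
Qed.

Definition on_sides Q (z : X) : Prop := exists P1 e P2 u,
  [/\ Q = P1 ++ e :: P2, lo e <= u <= hi e & z = geo e u].

(** The mark [u0] of [a] is the foot [p] of the chord. A point [q0] of the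
    other sides, at the level of [p], is found by continuity; the other end
    of the chord is the point [q], among the points of the other sides near
    [p q0], that is closest to [p] up to [delta]. By minimality, the chord is
    close to the marks of the other sides near [q] only, and by orthogonality
    it is not close to the other marks of [a]; so the two pieces of the
    polygon satisfy the hypotheses again. The condition on [u0] makes sure
    that both pieces have at least five sides. *)
Lemma cut_chord a Q u0 : polygon H (3 * delta) (a :: Q) -> (0 < size Q)%N ->
  u0 \in marks a ->
  (forall P1 e P2, Q = P1 ++ e :: P2 -> (size P1 < 2)%N || (size P2 < 2)%N ->
     ~ near_seg (13 * delta) (src e) (tgt e) (geo a u0)) ->
  exists P1 e P2 u,
    [/\ Q = P1 ++ e :: P2, lo e <= u <= hi e,
        (2 <= size P1)%N /\ (2 <= size P2)%N,
        (forall z, on_sides Q z ->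
           near_seg (3 * delta) (geo a u0) (geo e u) z ->
           mdist z (geo e u) <= 8 * delta) &
        (forall w, w \in marks a -> w != u0 ->
           ~ near_seg (3 * delta) (geo a u0) (geo e u) (geo a w))].
Proof.
have d0 := delta_gt0; have Hl := H_large.
case=> -[x [ax aQ]] /= /andP[/asboolP va vQ] _ Q0 u0a away.
have bu0 := marks_bounds va u0a; have [_ isa _ _] := va.
pose p := geo a u0; pose y := tgt a; rewrite -/y in aQ.
have xyp : btw x y p by rewrite -ax; apply: (isom_btw isa); lra.
have px : mdist p x = u0 - lo a.
  by rewrite -ax isa ?ger0_norm//; lra.
have py : mdist p y = hi a - u0.
  by rewrite isa ?ler0_norm//; lra.
have xy : mdist x y = hi a - lo a.
  by rewrite -ax isa ?ler0_norm//; lra.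
pose phi z := mdist z x - mdist z y.
have [|||Q1 [e0 [Q2 [w [Qe we lev]]]]] := @chain_level phi y Q x (phi p) _ aQ vQ.
- move=> z z'; rewrite ler_norml /phi.
  have := metric_triangle z z' x; have := metric_triangle z z' y.
  have := metric_triangle z' z x; have := metric_triangle z' z y.
  by rewrite (metric_sym z' z); lra.
- by [].
- rewrite /phi !mdistxx (metric_sym y) xy px py; lra.
pose q0 := geo e0 w.
have [levx levy] := level_dist slimX xyp lev; rewrite -/q0 in lev levx levy.
pose E := [set t | exists z, [/\ on_sides Q z, near_seg (4 * delta) p q0 z &
  t = mdist p z]].
have lbE : lbound E 0 by move=> t [z [_ _ ->]]; apply: mdist_ge0.
have infE : has_inf E.
  split; last by exists 0.
  exists (mdist p q0), q0; split=> //; first by exists Q1, e0, Q2, w.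
  by exists q0; [exact: btw_r|rewrite mdistxx; lra].
have [t [q [Aq nq ->]] qinf] := inf_adherent d0 infE.
have qmin z : on_sides Q z -> near_seg (4 * delta) p q0 z ->
    mdist p q <= mdist p z + delta.
  move=> Az nz; have : inf E <= mdist p z.
    by apply: ge_inf; [exists 0|exists z].
  by lra.
have dx := near_level_dist levx nq; have dy := near_level_dist levy nq.
have ny := near_of_defect delta_gt0 slimX dy (geodX _ _).
have nx := near_of_defect delta_gt0 slimX dx (geodX _ _).
case: (Aq) => P1 [e [P2 [u [Qeq ue qe]]]].
have ve : valid_side H e.
  by move: vQ; rewrite Qeq all_cat => /andP[_ /= /andP[/asboolP]].
have [z yz /= [ze eP2]] : exists2 z, chain y P1 z & chain z (e :: P2) x.
  by apply/chain_cat; rewrite -Qeq.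
rewrite -ze {z ze} in yz.
exists P1, e, P2, u; split => //.
- split; rewrite leqNgt; apply/negP => sP.
    rewrite qe in ny.
    have [i ic ni] := near_side_short yz sP ve ue ny.
    case: P1 i sP Qeq ic ni {yz} => [|b [|//]] [|[|//]] //= _ Qeq _.
    + by move/(away [::] e P2 Qeq isT).
    + by move/(away [::] b (e :: P2) Qeq isT).
    + by move/(away [:: b] e P2 Qeq isT).
  rewrite qe in nx.
  have [i ic ni] := near_side_short_rev eP2 sP ve ue nx.
  case: P2 i sP Qeq ic ni {eP2} => [|b [|//]] [|[|//]] //= _ Qeq _.
  + by move/(away P1 e [::] Qeq); rewrite orbT; apply.
  + by move/(away P1 e [:: b] Qeq); rewrite orbT; apply.
  + rewrite -cat_rcons in Qeq.
    by move/(away (rcons P1 e) b [::] Qeq); rewrite orbT; apply.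
- rewrite -/p -qe => z Az nz.
  exact: (near_closest delta_gt0 slimX nq qmin Az nz).
- rewrite -/p -qe => v vm vu0 nv; have bv := marks_bounds va vm.
  have := marks_gap va vm u0a vu0; rewrite isa// => gap.
  have := orthogonal_dist delta_gt0 slimX levx nq nv.
  have := orthogonal_dist delta_gt0 slimX levy nq nv.
  rewrite px py -ax !isa; try lra.
  rewrite [X in _ -> _ <= X -> _]ger0_norm; last by lra.
  rewrite ler0_norm; last by lra.
  by case: (lerP 0 (v - u0)) gap => ?; [rewrite ger0_norm//|rewrite ltr0_norm//]; lra.
Qed.

End CutPolygons.

Lemma size_ltgt (R : realType) (s : seq R) (u : R) : size s =
  (count (fun w => w < u)%R s + count (fun w => u < w)%R s + count_mem u s)%N.
Proof. by elim: s => //= w s ->; case: (ltgtP w u) => _ /=; lia. Qed.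

Lemma pairwise_gap_uniq (R : realType) (H : R) s : 0 < H ->
  pairwise (fun u v => u + H <= v) s -> uniq s.
Proof.
move=> H0; rewrite uniq_pairwise; apply: sub_pairwise => u v /= uv.
by apply/eqP => e; move: uv; rewrite e; lra.
Qed.

Section PolygonMarks.
Variables (R : realType) (X : metricType R) (delta H : R).
Hypotheses (delta_gt0 : 0 < delta) (slimX : slim X delta).
Hypothesis geodX : forall x y : X, exists p, geodesic x y p.
Hypothesis H_large : 20 * delta <= H.
Implicit Types (a b : side X) (P Q : seq (side X)).

Lemma lonely_chord p q e (c n : side X) : valid_side H c ->
  (forall u, u \in marks c -> near_seg (3 * delta) p q (geo c u) ->
     mdist (geo c u) e <= 8 * delta) ->
  (forall z, near_seg (3 * delta) (src n) (tgt n) z -> near_seg (3 * delta) p q z) ->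
  marks n = [::] -> apart (3 * delta) c n.
Proof.
have d0 := delta_gt0; have Hl := H_large.
move=> vc near_e nn n0; apply/asboolP; split; last exact: lonely_nil.
move=> u v uc vc' /nn nu /nn nv; apply/eqP/negPn/negP => uv.
have := marks_gap vc uc vc' uv; have := near_e u uc nu; have := near_e v vc' nv.
have := metric_triangle (geo c u) e (geo c v).
by rewrite (metric_sym e); lra.
Qed.

Lemma geodesic_side (x y : X) : exists n : side X,
  [/\ src n = x, tgt n = y, marks n = [::] & valid_side H n].
Proof.
have [g [g0 g1 ig]] := geodX x y.
by exists (Side g 0 (mdist x y) [::]); split=> //; split=> //=; apply: mdist_ge0.
Qed.

(** Two sides are cut and the chord is counted twice, hence the four
    additional sides; the foot of the chord is the only mark that is lost. *)
Lemma polygon_cut a Q : polygon H (3 * delta) (a :: Q) ->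
  (12 < size (marks a))%N -> (4 <= size Q)%N ->
  exists P1 P2, [/\ polygon H (3 * delta) P1, polygon H (3 * delta) P2,
    (5 <= size P1)%N /\ (5 <= size P2)%N,
    (size P1 + size P2 = (size Q).+1 + 4)%N &
    (nmarks (a :: Q) = nmarks P1 + nmarks P2 + 1)%N].
Proof.
have d0 := delta_gt0; have Hl := H_large.
move=> polQ a12 Q4; have [[x [ax aQ]] /= /andP[/asboolP va vQ]] := polQ.
move=> /andP[apQ pwQ].
have [u0 u0a away] : exists2 u, u \in marks a &
    all (fun b =>
      ~~ `[< near_seg (13 * delta) (src b) (tgt b) (geo a u) >]) [:: nth a Q 0; nth a Q 1;
      nth a Q (size Q - 1)%N; nth a Q (size Q - 2)%N].
  apply: (mark_away delta_gt0 slimX H_large va) => //=.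
  have la i : (i < size Q)%N -> `[< lonely (3 * delta) a (nth a Q i) >].
    by move=> iQ; apply/asboolP; move/all_nthP: apQ => /(_ a i iQ) /asboolP[].
  by rewrite !la//; lia.
have [P1 [e [P2 [u [Qe ue [P12 P22] near_q far_a]]]]] : exists P1 e P2 u,
    [/\ Q = P1 ++ e :: P2, lo e <= u <= hi e,
        (2 <= size P1)%N /\ (2 <= size P2)%N,
        (forall z, on_sides Q z ->
           near_seg (3 * delta) (geo a u0) (geo e u) z ->
           mdist z (geo e u) <= 8 * delta) &
        (forall w, w \in marks a -> w != u0 ->
           ~ near_seg (3 * delta) (geo a u0) (geo e u) (geo a w))].
  apply: (cut_chord delta_gt0 slimX geodX H_large polQ _ u0a); first lia.
  move=> P1 e P2 Qe sP; apply/asboolPn.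
  have en : e = nth a Q (size P1) by rewrite Qe nth_cat ltnn subnn.
  have sQ : size Q = (size P1 + size P2).+1 by rewrite Qe size_cat addnS.
  move: away => /= /and5P[n0 n1 n2 n3 _].
  have : [|| size P1 == 0, size P1 == 1, size P1 == size Q - 1
    | size P1 == size Q - 2]%N by move: sP sQ; clear; lia.
  by rewrite en; case/or4P => /eqP ->.
set p := geo a u0 in near_q far_a; set q := geo e u in near_q far_a.
have bu0 := marks_bounds va u0a; have [_ isa pa _] := va.
have vQ' P c P' : Q = P ++ c :: P' -> valid_side H c.
  by move=> Qc; move: vQ; rewrite Qc all_cat => /andP[_ /andP[/asboolP]].
have ve := vQ' _ _ _ Qe.
have on_c P c P' v : Q = P ++ c :: P' -> v \in marks c -> on_sides Q (geo c v).
  move=> Qc vc; exists P, c, P', v; split => //.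
  exact: marks_bounds (vQ' _ _ _ Qc) vc.
have [n1 [n1q n1p n1m vn1]] := geodesic_side q p.
have [n2 [n2p n2q n2m vn2]] := geodesic_side p q.
have sep1 P c P' : Q = P ++ c :: P' -> apart (3 * delta) c n1.
  move=> Qc; apply: (@lonely_chord p q q) => //; first exact: vQ' Qc.
    by move=> v vc; apply: near_q; apply: on_c Qc vc.
  by move=> z; rewrite n1q n1p; apply: near_segC.
have sep2 P c P' : Q = P ++ c :: P' -> apart (3 * delta) c n2.
  move=> Qc; apply: (@lonely_chord p q q) => //; first exact: vQ' Qc.
    by move=> v vc; apply: near_q; apply: on_c Qc vc.
  by move=> z; rewrite n2q n2p.
pose a1 := restr a (lo a) u0 (fun w => w < u0).
pose a2 := restr a u0 (hi a) (fun w => u0 < w).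
pose e1 := restr e (lo e) u (fun w => w <= u).
pose e2 := restr e u (hi e) (fun w => u < w).
have va1 : valid_side H a1 by apply: restr_valid => // *; lra.
have va2 : valid_side H a2 by apply: restr_valid => // *; lra.
have ve1 : valid_side H e1 by apply: restr_valid => // *; lra.
have ve2 : valid_side H e2 by apply: restr_valid => // *; lra.
have far_n (b n : side X) (P : pred R) lb hb : b = restr a lb hb P ->
    (forall w, P w -> w != u0) ->
    (forall z, near_seg (3 * delta) (src n) (tgt n) z ->
       near_seg (3 * delta) p q z) -> marks n = [::] -> apart (3 * delta) b n.
  move=> -> Pw nn n0; apply/asboolP; split; last exact: lonely_nil.
  move=> w w'; rewrite mem_filter => /andP[/Pw wu wa] _ /nn nw.
  by case: (far_a w wa wu).
have a2n1 : apart (3 * delta) a2 n1.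
  apply: (@far_n _ n1 (fun w => u0 < w) u0 (hi a)) => // [w|z].
    by rewrite lt_neqAle eq_sym => /andP[].
  by rewrite n1q n1p; apply: near_segC.
have a1n2 : apart (3 * delta) a1 n2.
  apply: (@far_n _ n2 (fun w => w < u0) (lo a) u0) => // [w|z].
    by rewrite lt_neqAle => /andP[].
  by rewrite n2q n2p.
have apa1 b : apart (3 * delta) a b -> apart (3 * delta) a1 b.
  by move=> ab; apply: (apart_restr _ va _ _ _ ab); lra.
have apa2 b : apart (3 * delta) a b -> apart (3 * delta) a2 b.
  by move=> ab; apply: (apart_restr _ va _ _ _ ab); lra.
have ape1 b : apart (3 * delta) e b -> apart (3 * delta) e1 b.
  by move=> eb; apply: (apart_restr _ ve _ _ _ eb); lra.
have ape2 b : apart (3 * delta) e b -> apart (3 * delta) e2 b.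
  by move=> eb; apply: (apart_restr _ ve _ _ _ eb); lra.
move: apQ; rewrite Qe all_cat /= => /and3P[aP1 ae aP2].
move: pwQ; rewrite Qe pairwise_cat allrel_consr /= => /and3P[].
move=> /andP[P1e P1P2] pwP1 /andP[eP2 pwP2].
have [y ayP1 /= [ye eP2x]] : exists2 y, chain (tgt a) P1 y & chain y (e :: P2) x.
  by apply/chain_cat; rewrite -Qe.
rewrite -ye {y ye} in ayP1.
move: vQ; rewrite Qe all_cat /= => /and3P[vP1 _ vP2].
have swap (c d : side X) : apart (3 * delta) d c -> apart (3 * delta) c d.
  by rewrite apartC.
exists (a2 :: P1 ++ [:: e1; n1]), (a1 :: n2 :: e2 :: P2); split.
- split.
  + exists p => /=; split=> //; apply/chain_cat; by exists (src e).
  + by rewrite /= all_cat vP1 /= andbT; apply/and3P; split; apply/asboolP.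
  + rewrite /= all_cat pairwise_cat pwP1 allrel_consr allrel1r /= a2n1 !andbT.
    apply/and3P; split; [apply/andP; split|apply/andP; split|].
    * exact: sub_all aP1.
    * by apply: apa2; apply: (swap); apply: ape1; apply: (swap).
    * by apply: sub_all P1e => c ce; apply: (swap); apply: ape1; apply: (swap).
    * by apply: all_split => s1 c s2 Pc; apply: (sep1 s1 c (s2 ++ e :: P2));
        rewrite Qe Pc -catA.
    * by apply: ape1; apply: sep1 Qe.
- split.
  + exists x => /=; rewrite n2p n2q; split => //.
  + by rewrite /= vP2 andbT; apply/and3P; split; apply/asboolP.
  + rewrite /= pwP2 a1n2 andbT /=.
    apply/and3P; split; [apply/andP; split|apply/andP; split|].
    * by apply: apa1; apply: (swap); apply: ape2; apply: (swap).
    * exact: sub_all aP2.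
    * by apply: (swap); apply: ape2; apply: sep2 Qe.
    * apply: all_split => s1 c s2 Pc; apply: (swap).
      by apply: (sep2 (P1 ++ e :: s1) c s2); rewrite Qe Pc -catA.
    * exact: sub_all eP2.
- by rewrite /= size_cat /=; move: P12 P22; clear; lia.
- by rewrite /= !size_cat /=; clear; lia.
- rewrite !nmarks_cons !nmarks_cat !nmarks_cons n1m n2m /=.
  rewrite (size_ltgt (marks a) u0) (count_uniq_mem _ (pairwise_gap_uniq _ pa)).
    rewrite u0a !size_filter -(count_predC (fun w => w <= u) (marks e)).
    rewrite (@eq_count _ (predC _) (fun w => u < w)); last first.
      by move=> w /=; rewrite ltNge.
    have -> : nmarks ([::] : seq (side X)) = 0%N by [].
    set c1 := count (fun w => w < u0) _; set c2 := count (fun w => u0 < w) _.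
    set c3 := count (fun w => w <= u) _; set c4 := count (fun w => u < w) _.
    by rewrite /= !add0n addn0; clear; lia.
  by lra.
Qed.

(** The number of marks is at most [61 * (n - 4) - 1] for [n >= 5] sides, by
    induction. A bound of the form [a * (n - 4) - 1] survives the cut of a
    polygon into two smaller ones with [n + 4] sides in total, the loss of the
    foot of the chord included. A polygon with at most 12 marks on each side
    satisfies the bound for [a = 61]; otherwise a side with 13 marks has one
    that is not close to its two neighbours on either side, as at most three
    marks are close to each of them. *)
Lemma polygon_marks P : polygon H (3 * delta) P -> (5 <= size P)%N ->
  (nmarks P + 245 <= 61 * size P)%N.
Proof.
have [n] := ubnP (size P); elim: n P => // n IHn P Pn polP P5.
have [|few] := EM (exists P1 a P2,
    P = P1 ++ a :: P2 /\ (12 < size (marks a))%N); last first.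
  have le12 : (nmarks P <= 12 * size P)%N.
    have : all (fun a => size (marks a) <= 12)%N P.
      apply: all_split => P1 a P2 Pe; rewrite leqNgt; apply/negP => a12.
      by apply: few; exists P1, a, P2.
    elim: P {few Pn polP P5} => //= a P IHP /andP[a12 /IHP].
    by rewrite nmarks_cons mulnS; move: a12; clear; lia.
  by move: le12 P5; clear; lia.
case=> P1 [a [P2 [Pe a12]]]; have := polP; rewrite Pe => /polygon_rot polP'.
have sP : size P = (size (P2 ++ P1)).+1.
  by rewrite Pe !size_cat /= addnS addnC.
have mP : nmarks P = nmarks (a :: P2 ++ P1).
  by rewrite Pe -cat_cons !nmarks_cat addnC.
have [|Q1 [Q2 [pol1 pol2 [Q15 Q25] sQ mQ]]] := @polygon_cut a (P2 ++ P1) polP' a12.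
  by move: P5; rewrite sP.
have m1 : (nmarks Q1 + 245 <= 61 * size Q1)%N.
  by apply: IHn => //; move: Pn; rewrite sP; move: sQ Q25; clear; lia.
have m2 : (nmarks Q2 + 245 <= 61 * size Q2)%N.
  by apply: IHn => //; move: Pn; rewrite sP; move: sQ Q15; clear; lia.
by rewrite -Pe mP mQ sP; move: m1 m2 sQ; clear; lia.
Qed.

End PolygonMarks.

Lemma linear_le_exp2 (R : realType) (A B : R) : 0 <= A -> 0 <= B ->
  exists k0 : nat, forall k, (k0 <= k)%N -> A * k%:R + B <= 2 ^+ k.
Proof.
move=> A0 B0; have [n ABn] : exists n : nat, A + B < n%:R.
  by exists (Num.Def.archi_bound (A + B)); apply: archi_boundP; lra.
exists (n + 4)%N => k nk.
have sq : (k ^ 2 <= 2 ^ k)%N.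
  have -> : k = (k - 4 + 4)%N by lia.
  elim: (k - 4)%N => // m; rewrite addSn (expnS 2) !expnS !expn0; nia.
have k1 : 1 <= k%:R :> R by rewrite ler1n; lia.
have kn : n%:R <= k%:R :> R by rewrite ler_nat; lia.
have : (k ^ 2)%:R <= (2 ^ k)%:R :> R by rewrite ler_nat.
rewrite !natrX => sqR; apply: le_trans sqR.
rewrite expr2; nra.
Qed.

(** * Geodesics are close to quasi-geodesics *)

Section QuasiGeodesics.
Variables (R : realType) (X : metricType R) (delta : R).
Hypotheses (delta_gt0 : 0 < delta) (slimX : slim X delta).
Hypothesis geodX : forall x y : X, exists p, geodesic x y p.

(** Halving the path costs [delta] at each step. *)
Lemma near_chain (a : nat -> X) (J : R) k s t z : 0 <= J ->
  (s <= t <= s + 2 ^ k)%N ->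
  (forall i, (s <= i < t)%N -> mdist (a i) (a i.+1) <= J) ->
  btw (a s) (a t) z ->
  exists2 r, (s <= r <= t)%N & mdist z (a r) <= k%:R * delta + J.
Proof.
have d0 := delta_gt0.
move=> J0; elim: k s t z => [|k IHk] s t z /andP[st tsk] step stz.
  exists s; first by rewrite leqnn.
  rewrite mul0r add0r; rewrite /btw in stz.
  rewrite (metric_sym z); have := mdist_ge0 z (a t).
  have [ts|ts] : t = s \/ t = s.+1 by move: st tsk; rewrite expn0; clear; lia.
    by rewrite ts mdistxx in stz *; lra.
  by have := step s; rewrite ts leqnn ltnSn => /(_ isT); rewrite ts in stz; lra.
have kk : k.+1%:R = k%:R + 1 :> R by rewrite -addn1 natrD.
have [tk|tk] := leqP t (s + 2 ^ k).
  have [|r rst zr] := IHk s t z _ step stz; first by rewrite st.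
  by exists r => //; rewrite kk; lra.
set m := (s + 2 ^ k)%N in tk; have sm : (s <= m)%N by apply: leq_addr.
have [b [sb|tb] zb] := slimX (a m) stz.
  have [||r rst br] := IHk s m b _ _ sb.
  - by rewrite sm /=.
  - by move=> i /andP[si im]; apply: step; rewrite si (ltn_trans im).
  exists r; first by move: rst tk; clear; lia.
  by have := metric_triangle z b (a r); rewrite kk; lra.
have [||r rst br] := IHk m t b _ _ (btwC tb).
- by rewrite ltnW//= /m -addnA addnn -mul2n -expnS.
- by move=> i /andP[mi it]; apply: step; rewrite (leq_trans sm).
exists r; first by move: rst sm; clear; lia.
by have := metric_triangle z b (a r); rewrite kk; lra.
Qed.

(** The statement for a constant [D (k + 1)] implies the one for [D k], as long
    as [2 ^ k] exceeds a linear function of [k]: the points at distance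
    [2 D (k + 1)] from [z] on either side are joined by a detour along the
    path, far from [z] at its ends, whose length is linear in [D (k + 1)], so
    that [near_chain] applies with [k] halvings. The statement holds for a
    large constant, that depends on the path, hence for [D k0], that does
    not. *)
Lemma quasigeodesic_near (lam c J : R) : 0 <= lam -> 0 <= c -> 0 <= J ->
  exists2 D : R, 0 <= D & forall (a : nat -> X) s t z, (s <= t)%N ->
  (forall i, (s <= i < t)%N -> mdist (a i) (a i.+1) <= J) ->
  (forall i j, (s <= i)%N -> (i <= j)%N -> (j <= t)%N ->
     (j - i)%:R <= lam * mdist (a i) (a j) + c) ->
  btw (a s) (a t) z ->
  exists2 r, (s <= r <= t)%N & mdist z (a r) <= D.
Proof.
have d0 := delta_gt0; move=> lam0 c0 J0.
pose D (k : nat) : R := (k%:R + 2) * delta + J.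
have [k0 k0P] : exists k0 : nat, forall k, (k0 <= k)%N ->
    lam * (6 * D k.+1) + c <= 2 ^+ k.
  have [||k0 k0P] := @linear_le_exp2 R (lam * 6 * delta)
    (lam * 6 * (3 * delta + J) + c).
  - by apply: mulr_ge0; lra.
  - by apply: addr_ge0 => //; apply: mulr_ge0; lra.
  exists k0 => k /k0P; apply: le_trans.
  by rewrite /D -addn1 natrD; lra.
have D0 k : 2 * delta <= D k.
  have : 0 <= k%:R * delta by rewrite mulr_ge0// ltW.
  by rewrite /D; lra.
exists (D k0); first by have := D0 k0; lra.
move=> a s t z st step qg stz.
suff main n : (forall z, btw (a s) (a t) z ->
    exists2 r, (s <= r <= t)%N & mdist z (a r) <= D (k0 + n)%N) ->
  forall z, btw (a s) (a t) z ->
    exists2 r, (s <= r <= t)%N & mdist z (a r) <= D k0.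
  pose n := Num.Def.archi_bound (mdist (a s) (a t) / delta).
  apply: (main n) => // z' stz'; exists s; first by rewrite leqnn.
  have : mdist (a s) (a t) / delta < n%:R.
    by apply: archi_boundP; apply: divr_ge0; rewrite ?mdist_ge0// ltW.
  rewrite ltr_pdivrMr// => an; rewrite /btw in stz'; rewrite metric_sym.
  have : 0 <= k0%:R * delta by rewrite mulr_ge0// ltW.
  by rewrite /D natrD; have := mdist_ge0 z' (a t); lra.
elim: n {z stz} => [|n IHn]; first by rewrite addn0.
move=> Hn; apply: IHn; rewrite addnS in Hn.
set k := (k0 + n)%N in Hn *; have {k0P} kP := k0P k (leq_addr _ _).
have Dk : D k.+1 = D k + delta by rewrite /D -addn1 natrD; ring.
have Dk3 : 3 * delta <= D k.+1 by have := D0 k; lra.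
move=> z stz.
(* Far from [e], the point [y] is chosen at distance [2 * D k.+1] from [z], so
   that the way from [y] to the path stays far from [z]. *)
have half e r0 : (s <= r0 <= t)%N -> e = a r0 ->
    (forall y, btw e z y -> btw (a s) (a t) y) ->
  exists y r1, [/\ btw e z y, mdist y z <= 2 * D k.+1, (s <= r1 <= t)%N,
    mdist y (a r1) <= D k.+1 &
    forall b, btw y (a r1) b -> mdist z b <= 2 * delta ->
      exists2 r, (s <= r <= t)%N & mdist z (a r) <= D k].
  move=> r0st er0 sub; have [ez|ez] := lerP (mdist e z) (2 * D k.+1).
    exists e, r0; split=> //; first exact: btw_l.
      by rewrite er0 mdistxx; lra.
    move=> b; rewrite -er0 /btw mdistxx => eb zb.
    exists r0 => //; rewrite -er0; have := metric_triangle z b e.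
    have := mdist_ge0 e b; rewrite (metric_sym b) in eb *.
    by have := D0 k; lra.
  have [g [g0 g1 ig]] := geodX z e.
  have ze := metric_sym z e.
  pose y := g (2 * D k.+1).
  have zy : mdist z y = 2 * D k.+1.
    by rewrite -{1}g0 ig ?ler0_norm; lra.
  have ye : mdist y e = mdist e z - 2 * D k.+1.
    by rewrite -{1}g1 ig ?ler0_norm; lra.
  have ezy : btw e z y by rewrite /btw (metric_sym e y) (metric_sym y z) ye zy; lra.
  have [r1 r1st yr1] := Hn y (sub _ ezy).
  exists y, r1; split=> //; first by rewrite metric_sym zy.
  move=> b; rewrite /btw => yb zb.
  have := metric_triangle z b y; rewrite zy (metric_sym b).
  by have := mdist_ge0 b (a r1); lra.
have [||y1 [r1 [sy1 y1z r1st y1r near1]]] := half (a s) s _ erefl.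
- by rewrite leqnn.
- by move=> y; apply: btw_trans stz.
have [||y2 [r2 [ty2 y2z r2st y2r near2]]] := half (a t) t _ erefl.
- by rewrite leqnn andbT.
- by move=> y ty; apply/btwC/(btw_trans (btwC stz)).
have y12 : btw y1 y2 z.
  rewrite /btw in stz sy1 ty2 *.
  have := metric_triangle (a s) y1 (a t); have := metric_triangle y1 y2 (a t).
  have := metric_triangle y1 z y2.
  rewrite (metric_sym y2 (a t)) (metric_sym z y2).
  rewrite (metric_sym (a t) z) in ty2.
  by apply: contrapT; lra.
have [b [b1|b2] zb] := slimX (a r1) y12; first by apply: near1 b1 _; lra.
have [b' [b2'|b12] bb'] := slimX (a r2) b2.
  by apply: near2 b2' _; have := metric_triangle z b b'; lra.
have rr : mdist (a r1) (a r2) <= 6 * D k.+1.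
  have := metric_triangle (a r1) y1 (a r2); have := metric_triangle y1 y2 (a r2).
  have := metric_triangle y1 z y2.
  by rewrite (metric_sym (a r1) y1) (metric_sym z y2); lra.
have close i j : (s <= i)%N -> (i <= j)%N -> (j <= t)%N ->
    mdist (a i) (a j) <= 6 * D k.+1 -> (j <= i + 2 ^ k)%N.
  move=> si ij jt dij; rewrite -leq_subLR -(ler_nat R) natrX.
  apply: le_trans (qg _ _ si ij jt) _; apply: le_trans kP.
  by rewrite lerD2r ler_wpM2l.
have zD r : mdist b' (a r) <= k%:R * delta + J -> mdist z (a r) <= D k.
  have := metric_triangle z b (a r); have := metric_triangle b b' (a r).
  by rewrite /D; lra.
case/andP: r1st => sr1 r1t; case/andP: r2st => sr2 r2t.
have [r12|r21] := leqP r1 r2.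
  have [||r rst br] := @near_chain a J k r1 r2 b' J0 _ _ b12.
  - by rewrite r12 close.
  - by move=> i ir; apply: step; move: ir sr1 r2t; clear; lia.
  by exists r; [move: rst sr1 r2t; clear; lia|exact: zD].
have [||r rst br] := @near_chain a J k r2 r1 b' J0 _ _ (btwC b12).
- rewrite (ltnW r21) /=; apply: close => //; first exact: ltnW.
  by rewrite metric_sym.
- by move=> i ir; apply: step; move: ir sr2 r1t; clear; lia.
by exists r; [move: rst sr2 r1t; clear; lia|exact: zD].
Qed.

End QuasiGeodesics.

(** * Conjugates of powers in free groups *)

Section FreeGroupWords.
Variable A : choiceType.
Implicit Types (u v : seq (letter A)) (g h w : free_group A).

Lemma size_free_reduce u : (size (free_reduce u) <= size u)%N.
Proof.
elim: u => //= l u IHu; rewrite /free_reduce /= -/(free_reduce u).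
apply: (@leq_trans (size (free_reduce u)).+1) => //.
by case: (free_reduce u) => //= l' s; case: ifP => //= _; lia.
Qed.

Lemma free_of_word_cat u v :
  free_of_word (u ++ v) = (free_of_word u * free_of_word v)%g.
Proof. by apply: val_inj; rewrite /= free_reduce_catl free_reduce_catr. Qed.

Lemma free_of_word_inv u :
  free_of_word (rev (map (@linv A) u)) = (free_of_word u)^-1%g.
Proof.
apply: (@mulIg _ (free_of_word u)); rewrite mulVg -free_of_word_cat.
by apply: val_inj; rewrite /= free_reduce_invl.
Qed.

Lemma free_of_wordK w : free_of_word w = w.
Proof. by apply: val_inj; rewrite /= free_reduce_id// word_of_reduced. Qed.

Lemma free_of_word_pow u n :
  free_of_word (flatten (nseq n u)) = (free_of_word u ^+ n)%g.
Proof. by elim: n => //= n IHn; rewrite free_of_word_cat IHn expgS. Qed.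

Lemma path_cycle_pow u n x : cyclically_reduced u -> u != [::] ->
  path (@compat A) x u ->
  path (@compat A) x (flatten (nseq n.+1 u)) /\
  last x (flatten (nseq n.+1 u)) = last x u.
Proof.
case: u => // m u cu _; elim: n x => [|n IHn] x xu; first by rewrite /= cats0.
have uu : path (@compat A) (last x (m :: u)) (m :: u).
  by move: cu; rewrite /cyclically_reduced /= rcons_path andbC.
have [pn ln] := IHn _ uu.
rewrite (_ : flatten (nseq n.+2 (m :: u)) =
  (m :: u) ++ flatten (nseq n.+1 (m :: u)))//.
by rewrite cat_path last_cat xu pn ln.
Qed.

Lemma cyclically_reduced_pow u n : cyclically_reduced u ->
  reduced (flatten (nseq n u)).
Proof.
case: n => // n; case: u => [|m u] cu; first by elim: n.
have uu : path (@compat A) (last m u) (m :: u).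
  by move: cu; rewrite /cyclically_reduced /= rcons_path andbC.
by have [/path_sorted] := path_cycle_pow n cu isT uu.
Qed.

Lemma word_of_pow g n : cyclically_reduced g ->
  word_of (g ^+ n)%g = flatten (nseq n (word_of g)).
Proof.
move=> cg; rewrite -{1}[g]free_of_wordK -free_of_word_pow.
exact/free_reduce_id/cyclically_reduced_pow.
Qed.

(** Strip the first letter and the last one while they are inverse. *)
Lemma cyclic_core u : reduced u -> exists a c,
  [/\ u = a ++ c ++ rev (map (@linv A) a), cyclically_reduced c &
      c = [::] -> u = [::]].
Proof.
have [n] := ubnP (size u); elim: n u => // n IHn u un ru.
have [cu|ncu] := boolP (cyclically_reduced u).
  by exists [::], u; rewrite /= cats0.
case: u un ru ncu => // l t; case/lastP: t => [|t l'].
  by rewrite /cyclically_reduced /= /compat /linv; case: l => a [] /=;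
    rewrite xpair_eqE andbF.
rewrite /cyclically_reduced /= => tn; rewrite /reduced /= => lt.
rewrite rcons_path lt /= last_rcons => /negbTE/compatN ll'.
have [||a [c [te cc c0]]] := IHn t.
- by move: tn; rewrite size_rcons; lia.
- by move: lt; rewrite rcons_path => /andP[/path_sorted].
exists (l :: a), c; split=> //.
  rewrite /= rev_cons te !rcons_cat; congr (_ :: _ ++ _ ++ rcons _ _).
  by rewrite ll' linvK.
move=> /c0 t0; move: lt; rewrite t0 /= ll' andbT.
by rewrite -{2}[l']linvK compat_linv.
Qed.

(** If [g] is not cyclically reduced, its powers start with a letter and end
    with its inverse, as [g] does, because the powers of its core are
    reduced. *)
Lemma cyclically_reduced_root g n : (0 < n)%N ->
  cyclically_reduced (g ^+ n)%g ->
  cyclically_reduced g /\ word_of (g ^+ n)%g = flatten (nseq n (word_of g)).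
Proof.
case: n => // n _ cgn.
have [a [c [ge cc c0]]] := cyclic_core (word_of_reduced g).
case: a ge => [|l a] ge.
  have {}ge : word_of g = c by rewrite ge /= cats0.
  by have cg : cyclically_reduced g; [rewrite ge|rewrite word_of_pow].
have c1 : c != [::].
  by apply/eqP => /c0 g0; move: ge; rewrite g0.
have gA : (g ^+ n.+1)%g = free_of_word ((l :: a) ++ flatten (nseq n.+1 c) ++
    rev (map (@linv A) (l :: a))).
  rewrite !free_of_word_cat free_of_word_pow free_of_word_inv.
  rewrite -[g]free_of_wordK ge !free_of_word_cat free_of_word_inv.
  set x := free_of_word _; set y := free_of_word _.
  by have := conjXg y x^-1%g n.+1; rewrite !conjgE invgK => <-; rewrite expgS.
have red : reduced ((l :: a) ++ flatten (nseq n.+1 c) ++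
    rev (map (@linv A) (l :: a))).
  have : path (@compat A) l (a ++ c ++ rev (map (@linv A) (l :: a))).
    by have := word_of_reduced g; rewrite ge.
  rewrite !cat_path => /and3P[pa pc pr].
  have [p1 l1] := path_cycle_pow n cc c1 pc.
  suff : path (@compat A) l (a ++ flatten (nseq n.+1 c) ++
    rev (map (@linv A) (l :: a))) by [].
  by rewrite cat_path pa cat_path p1 l1 pr.
have gW : word_of (g ^+ n.+1)%g = (l :: a) ++ flatten (nseq n.+1 c) ++
    rev (map (@linv A) (l :: a)) by rewrite gA; apply: free_reduce_id.
move: cgn; rewrite /cyclically_reduced gW /= rev_cons -!rcons_cat rcons_path last_rcons.
by rewrite -[X in compat _ X]linvK compat_linv andbF.
Qed.

(** The length of the powers of [w ^ h] grows linearly at the rate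
    [size (w ^ h)], and that of their conjugates by [h^-1] at most at the rate
    [size w]; the two differ by a bounded amount. *)
Lemma size_cyclically_reduced_conj w h : cyclically_reduced (w ^ h)%g ->
  (size (w ^ h)%g <= size w)%N.
Proof.
move=> cg; set g := (w ^ h)%g in cg *; rewrite leqNgt; apply/negP => wg.
have sz k : (k * size g <= size h + (k * size w + size h))%N.
  have -> : (k * size g = size (g ^+ k)%g)%N.
    rewrite word_of_pow//; move: (word_of g) => s.
    by elim: k => //= k IHk; rewrite mulSn IHk size_cat.
  rewrite /g -conjXg conjgE.
  have sm (x y : free_group A) : (size (x * y)%g <= size x + size y)%N.
    by apply: leq_trans (size_free_reduce _) _; rewrite size_cat.
  have sV (x : free_group A) : (size x^-1%g <= size x)%N.
    by apply: leq_trans (size_free_reduce _) _; rewrite size_rev size_map.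
  apply: leq_trans (sm _ _) (leq_add (sV _) _).
  apply: leq_trans (sm _ _) (leq_add _ (leqnn _)).
  elim: k => //= k IHk; rewrite expgS mulSn.
  exact: leq_trans (sm _ _) (leq_add (leqnn _) IHk).
have := sz (size h + size h).+1.
have := leq_mul (leqnn (size h + size h).+1) wg.
rewrite mulnS; move: (size g) (size w) (size h); clear; lia.
Qed.

End FreeGroupWords.

Section WordValues.
Variables (G : groupType) (S : set G).
Implicit Types (u v : seq (letter S)).

Lemma word_val_nil : word_val ([::] : seq (letter S)) = 1%g.
Proof. by rewrite /word_val big_nil. Qed.

Lemma word_val_cat u v : word_val (u ++ v) = (word_val u * word_val v)%g.
Proof. by rewrite /word_val big_cat. Qed.

Lemma word_val_cons l u : word_val (l :: u) = (letter_val l * word_val u)%g.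
Proof. by rewrite /word_val big_cons. Qed.

Lemma word_val_free_reduce u : word_val (free_reduce u) = word_val u.
Proof.
elim: u => //= l u IHu; rewrite /free_reduce /= -/(free_reduce u).
rewrite word_val_cons -IHu; case: (free_reduce u) => [|l' s] /=.
  by rewrite word_val_cons.
case: ifP => [_|/compatN ->]; first by rewrite word_val_cons.
rewrite word_val_cons /letter_val /linv /=.
by case: l => a [] /=; rewrite ?mulKg ?mulVKg.
Qed.

Lemma word_valM (g h : free_group S) :
  word_val (g * h)%g = (word_val g * word_val h)%g.
Proof. by rewrite [LHS]word_val_free_reduce word_val_cat. Qed.

Lemma word_valV (g : free_group S) : word_val g^-1%g = (word_val g)^-1%g.
Proof.
apply: (@mulIg _ (word_val g)); rewrite mulVg -word_valM mulVg.
exact: word_val_nil.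
Qed.

Lemma word_val_pow u n : word_val (flatten (nseq n u)) = (word_val u ^+ n)%g.
Proof.
elim: n => [|n IHn] /=; first exact: word_val_nil.
by rewrite word_val_cat IHn expgS.
Qed.

Lemma word_valJ (w h : free_group S) :
  word_val (w ^ h)%g = (word_val w ^ word_val h)%g.
Proof. by rewrite !conjgE !word_valM word_valV. Qed.

End WordValues.

(** * Finiteness from acylindricity *)

Lemma finite_uniform_bound (T : choiceType) (E : set T) (Q : T -> nat -> Prop) :
  finite_set E -> (forall e, E e -> exists n, Q e n) ->
  (forall e m n, (m <= n)%N -> Q e m -> Q e n) ->
  exists N, forall e, E e -> Q e N.
Proof.
move=> /finite_seqP[s ->] ex mono.
elim: s ex => [|e s IHs] ex; first by exists 0%N.
have [|N NP] := IHs; first by move=> f fs; apply: ex; rewrite /= inE fs orbT.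
have [n nP] := ex e (mem_head _ _).
exists (maxn n N) => f /=; rewrite inE => /orP[/eqP ->|fs].
  exact: mono (leq_maxl _ _) nP.
exact: mono (leq_maxr _ _) (NP _ fs).
Qed.

Section CayleyGraph.
Variables (R : realType) (G : groupType) (S : set G).

Lemma letter_valP : symmetric_set S -> forall l : letter S, S (letter_val l).
Proof.
move=> symS [s []]; rewrite /letter_val /=; first exact: set_valP.
exact/symS/set_valP.
Qed.

Lemma finite_ball m : finite_set S -> symmetric_set S ->
  finite_set [set word_val u | u in [set u : seq (letter S) | (size u <= m)%N]].
Proof.
move=> finS symS; elim: m => [|m IHm].
  apply: (@sub_finite_set _ _ [set 1%g]); last exact: finite_set1.
  move=> _ [u /= + <-]; rewrite leqn0 size_eq0 => /eqP ->.
  exact: word_val_nil.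
apply: (@sub_finite_set _ _ ([set 1%g] `|` [set (s * g)%g | s in S & g in
  [set word_val u | u in [set u : seq (letter S) | (size u <= m)%N]]])).
  move=> _ [[|l u] /= lu <-]; first by left; apply: word_val_nil.
  right; exists (letter_val l); first exact: letter_valP.
  by exists (word_val u); [exists u|rewrite word_val_cons].
by rewrite finite_setU; split; [exact: finite_set1|exact: finite_image2].
Qed.

Lemma walk_cat (V : Type) (E : V -> V -> Prop) m n x y z :
  walk E m x y -> walk E n y z -> walk E (m + n) x z.
Proof.
elim: m x => [|m IHm] x /=; first by move=> ->.
by move=> [t xt ty] yz; exists t => //; apply: IHm.
Qed.

Lemma walk_sym (V : Type) (E : V -> V -> Prop) m x y :
  (forall a b, E a b -> E b a) -> walk E m x y -> walk E m y x.
Proof.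
move=> symE; elim: m x => [|m IHm] x; first by move=> /= ->.
move=> [t xt /IHm ty]; rewrite -addn1; apply: walk_cat ty _.
by exists x => //; apply: symE.
Qed.

Lemma cayley_walk : symmetric_set S -> generates S ->
  forall g : G, exists n, forall x, walk (cayley_edge S) n x (x * g)%g.
Proof.
move=> symS genS g.
pose H := [set g : G | exists n, forall x, walk (cayley_edge S) n x (x * g)%g].
suff HT : H = setT by have : H g by rewrite HT.
apply: genS.
- by exists 0%N => x; rewrite mulg1.
- move=> a b [m am] [n bn]; exists (m + n)%N => x.
  apply: walk_cat (am x) _; apply: walk_sym.
    move=> c d [s Ss ->]; exists s^-1%g; first exact: symS.
    by rewrite mulgK.
  by have := bn (x * (a * b^-1))%g; rewrite !mulgA mulgVK.
- by move=> s Ss; exists 1%N => x /=; exists (x * s)%g => //; exists s.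
Qed.

Lemma path_metric_le (V : Type) (E : V -> V -> Prop) n x y :
  walk E n x y -> path_metric R E x y <= n%:R.
Proof.
move=> w; apply: ge_inf; last by exists n.
by exists 0 => _ [m _ <-].
Qed.

End CayleyGraph.

Section FellowTravelling.
Variables (R : realType) (G : groupType) (X : metricType R).
Variables (act : G -> X -> X) (delta : R).
Hypotheses (delta_gt0 : 0 < delta) (slimX : slim X delta).
Hypotheses (isomA : isometric_action act) (acyl : acylindrical act).

Lemma btw_close (x y p q : X) : btw x y p -> btw x y q ->
  `|mdist x p - mdist x q| <= 1 -> mdist p q <= 2 * delta + 1.
Proof.
move=> xyp xyq /ler_normlP[pq1 pq2].
have [b [xb|yb] pb] := slimX q xyp; rewrite /btw in xyp xyq.
  rewrite /btw in xb.
  have := metric_triangle p b q; have := metric_triangle x b p.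
  by rewrite (metric_sym b p); lra.
rewrite /btw in yb.
have := metric_triangle p b q; have := metric_triangle y b p.
rewrite (metric_sym b p) (metric_sym y p); rewrite (metric_sym y q) in yb.
by lra.
Qed.

(** Round the positions of [q1] and [q2] on the segment to integers. Two
    elements [u] and [u'] with the same rounded positions differ by
    [u' * u^-1], which moves the points [u x0] and [u v x0] by a bounded amount;
    acylindricity applies to these, as they are far apart. It matters that [M]
    depends neither on the length of the segment nor on [v]. *)
Lemma finite_fellows (x0 : X) (r : R) : 0 <= r -> exists M : R,
  forall sigma v : G, finite_set [set u | exists q1 q2,
    [/\ btw x0 (act sigma x0) q1, btw x0 (act sigma x0) q2,
        mdist (act u x0) q1 <= r, mdist (act (u * v)%g x0) q2 <= r &
        M <= mdist q1 q2]].
Proof.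
have d0 := delta_gt0; move=> r0; have [act1 actM actI] := isomA.
have dd0 : 0 <= 2 * r + 2 * delta + 1 by lra.
have [M [N [M0 MN]]] := acyl dd0.
exists (M + 2 * r) => sigma v; set y := act sigma x0.
pose T (k1 k2 : nat) := [set u | exists q1 q2,
  [/\ btw x0 y q1, btw x0 y q2,
      mdist (act u x0) q1 <= r, mdist (act (u * v)%g x0) q2 <= r &
      [/\ M + 2 * r <= mdist q1 q2, Num.truncn (mdist x0 q1) = k1 &
          Num.truncn (mdist x0 q2) = k2]]].
have tb (q : X) : btw x0 y q -> (Num.truncn (mdist x0 q) <
    (Num.truncn (mdist x0 y)).+1)%N.
  by rewrite /btw ltnS => xyq; apply: Num.Theory.le_truncn; have := mdist_ge0 q y; lra.
have close (q q' : X) : btw x0 y q -> btw x0 y q' ->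
    Num.truncn (mdist x0 q) = Num.truncn (mdist x0 q') ->
    mdist q q' <= 2 * delta + 1.
  move=> yq yq' qq'; apply: btw_close yq yq' _.
  have := truncn_itv (mdist_ge0 x0 q); have := truncn_itv (mdist_ge0 x0 q').
  by rewrite qq' -addn1 natrD ler_norml; lra.
set K := (Num.truncn (mdist x0 y)).+1.
apply: (@sub_finite_set _ _ (\bigcup_(k1 in `I_K) \bigcup_(k2 in `I_K) T k1 k2)).
  move=> u [q1 [q2 [y1 y2 u1 u2 q12]]].
  exists (Num.truncn (mdist x0 q1)); first exact: tb.
  exists (Num.truncn (mdist x0 q2)); first exact: tb.
  by exists q1, q2.
apply: bigcup_finite => [|k1 _]; first exact: finite_II.
apply: bigcup_finite => [|k2 _]; first exact: finite_II.
have [->|/set0P[u [q1 [q2 [y1 y2 u1 u2 [q12 k1q k2q]]]]]] := eqVneq (T k1 k2) set0.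
  exact: finite_set0.
have far : M <= mdist (act u x0) (act (u * v)%g x0).
  have := metric_triangle q1 (act u x0) q2.
  have := metric_triangle (act u x0) (act (u * v)%g x0) q2.
  by rewrite (metric_sym q1 (act u x0)); lra.
have fin := card_le_finite (MN _ _ far) (finite_II N).
apply: (sub_finite_set _ (finite_image (fun g => (g * u)%g) fin)).
move=> u' [q1' [q2' [y1' y2' u1' u2' [q12' k1q' k2q']]]].
exists (u' * u^-1)%g; last by rewrite mulgVK.
have := close _ _ y1 y1'; rewrite k1q k1q' => /(_ erefl) c1.
have := close _ _ y2 y2'; rewrite k2q k2q' => /(_ erefl) c2.
rewrite /=; have -> : act (u' * u^-1)%g (act u x0) = act u' x0.
  by rewrite -actM mulgVK.
have -> : act (u' * u^-1)%g (act (u * v)%g x0) = act (u' * v)%g x0.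
  by rewrite -actM mulgA mulgVK.
split.
  have := metric_triangle (act u x0) q1 (act u' x0).
  have := metric_triangle q1 q1' (act u' x0).
  by rewrite (metric_sym q1' (act u' x0)); lra.
have := metric_triangle (act (u * v)%g x0) q2 (act (u' * v)%g x0).
have := metric_triangle q2 q2' (act (u' * v)%g x0).
by rewrite (metric_sym q2' (act _ _)); lra.
Qed.

End FellowTravelling.

(** * Distances along the loops *)

Section CyclicLoops.
Variables (R : realType) (G : groupType) (S : set G).

Definition cyc_dist (L s t : nat) : nat :=
  minn (maxn s t - minn s t) (L - (maxn s t - minn s t)).

Lemma cycle_walk_ge L n (i j : 'I_L) : walk (@cycle_edge L) n i j ->
  (cyc_dist L i j <= n)%N.
Proof.
elim: n i => [|n IHn] i /=; first by move=> ->; rewrite /cyc_dist; lia.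
have ordSE (a : 'I_L) : val (ordS a) = (if (a.+1 < L)%N then a.+1 else 0%N).
  have := ltn_ord a; rewrite /= leq_eqVlt => /orP[/eqP aL|aL].
    by rewrite aL ltnn modnn.
  by rewrite aL modn_small.
move=> [z [->|->]] /IHn; rewrite /cyc_dist ordSE.
  by have := ltn_ord i; have := ltn_ord j; case: ifP; lia.
by have := ltn_ord z; have := ltn_ord j; case: ifP; lia.
Qed.

Lemma cycle_walk_exists L (i j : 'I_L) : exists n, walk (@cycle_edge L) n i j.
Proof.
have up n : forall i j : 'I_L, val j = (i + n)%N -> walk (@cycle_edge L) n i j.
  elim: n => [|n IHn] a b; first by rewrite addn0 => /val_inj.
  move=> bE; exists (ordS a); first by left.
  apply: IHn; rewrite bE /= modn_small; first by rewrite addSnnS.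
  by have := ltn_ord b; rewrite bE; lia.
have [ij|ji] := leqP i j; first by exists (j - i)%N; apply: up; rewrite subnKC.
exists (i - j)%N; apply: walk_sym; last by apply: up; rewrite subnKC// ltnW.
by move=> a b [ab|ab]; [right|left].
Qed.

Lemma cyc_dist_le_path_metric L (i j : 'I_L) :
  (cyc_dist L i j)%:R <= path_metric R (@cycle_edge L) i j.
Proof.
apply: lb_le_inf.
  by have [n ij] := cycle_walk_exists i j; exists n%:R, n.
by move=> _ [n /cycle_walk_ge ijn <-]; rewrite ler_nat.
Qed.

(** Up to translation, the rotated loop is the original one with its indices
    shifted cyclically, because the loop closes up. *)
Lemma rot_loop (v : seq (letter S)) j t : word_val v = 1%g ->
  (j < size v)%N -> (t < size v)%N ->
  word_val (take t (rot j v)) = ((word_val (take j v))^-1 * word_val (take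
    (if (j + t < size v)%N then (j + t)%N else (j + t - size v)%N) v))%g.
Proof.
move=> v1 jL tL; have vE : (word_val (take j v) * word_val (drop j v) = 1)%g.
  by rewrite -word_val_cat cat_take_drop.
have dE : word_val (drop j v) = (word_val (take j v))^-1%g.
  by apply: (@mulgI _ (word_val (take j v))); rewrite vE mulgV.
rewrite /rot take_cat size_drop; case: ifP => jt.
  rewrite ifT; last by lia.
  by rewrite takeD word_val_cat mulKg.
case: ifP => jt'; first by lia.
rewrite word_val_cat dE take_takel; last by lia.
by congr (_ * word_val (take _ v))%g; lia.
Qed.

Lemma loop_cyc_dist (v : seq (letter S)) j s t n (mu c : R) : 0 < mu ->
  word_val v = 1%g ->
  qi_embedding (path_metric R (@cycle_edge (size v)))
         (path_metric R (cayley_edge S)) mu c (@cayley_loop G S v) ->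
  (j < size v)%N -> (s < size v)%N -> (t < size v)%N ->
  (forall x, walk (cayley_edge S) n x
     (x * ((word_val (take s (rot j v)))^-1 * word_val (take t (rot j v))))%g) ->
  (cyc_dist (size v) s t)%:R <= mu * (n%:R + c).
Proof.
move=> mu0 v1 qi jL sL tL; rewrite !rot_loop// => wk.
pose sh a := if (j + a < size v)%N then (j + a)%N else (j + a - size v)%N.
have shL a : (a < size v)%N -> (sh a < size v)%N.
  by move=> aL; rewrite /sh; case: ifP; lia.
have := qi (Ordinal (shL s sL)) (Ordinal (shL t tL)) => /andP[lo _].
have := @path_metric_le R _ _ _ _ _ (wk (word_val (take (sh s) v))).
rewrite invgM invgK !mulgA mulgV mul1g mulgV mul1g -/(sh t) => up.
have {lo up} := le_trans lo up.
rewrite lerBlDr ler_pdivrMl// => le_n.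
apply: le_trans le_n.
have := cyc_dist_le_path_metric (Ordinal (shL s sL)) (Ordinal (shL t tL)).
congr (_ <= _); congr (_%:R); rewrite /= /cyc_dist /sh.
by case: ifP; case: ifP; lia.
Qed.

End CyclicLoops.

(** * Copies of powers are uniform quasi-geodesics *)

Lemma take_flatten_nseq (T : Type) (g : seq T) n i : (i <= n * size g)%N ->
  take i (flatten (nseq n g)) =
  flatten (nseq (i %/ size g) g) ++ take (i %% size g) g.
Proof.
have [g0|g0] := posnP (size g).
  rewrite g0 muln0 leqn0 => /eqP ->.
  by rewrite (size0nil g0) take0 div0n.
elim: n i => [|n IHn] i.
  by rewrite leqn0 => /eqP ->; rewrite div0n mod0n !take0.
rewrite mulSn => le.
rewrite (_ : flatten (nseq n.+1 g) = g ++ flatten (nseq n g))// take_cat.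
case: ltnP => ig; first by rewrite divn_small// modn_small.
have -> : (i %/ size g = ((i - size g) %/ size g).+1)%N.
  by rewrite -{1}(subnK ig) divnDr ?divnn ?g0 ?addn1// dvdnn.
have -> : (i %% size g = (i - size g) %% size g)%N.
  by rewrite -{1}(subnK ig) modnDr.
by rewrite IHn /= ?catA//; lia.
Qed.

Section Orbits.
Variables (R : realType) (G : groupType) (S : set G) (X : metricType R).
Variables (act : G -> X -> X) (x0 : X).
Hypothesis (isomA : isometric_action act).
Hypotheses (S_finite : finite_set S) (S_symmetric : symmetric_set S).

Lemma orbit_step : exists2 J : R, 0 <= J &
  forall l : letter S, mdist x0 (act (letter_val l) x0) <= J.
Proof.
have [||N NP] := @finite_uniform_bound G S
  (fun s n => mdist x0 (act s x0) <= n%:R) S_finite.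
- move=> s _; exists (Num.Def.archi_bound (mdist x0 (act s x0))).
  by apply/ltW/archi_boundP/mdist_ge0.
- by move=> s m n mn /le_trans; apply; rewrite ler_nat.
by exists N%:R => // l; apply: NP; apply: letter_valP.
Qed.

Lemma orbit_word J : (forall l : letter S, mdist x0 (act (letter_val l) x0) <= J) ->
  forall (g : G) (u : seq (letter S)),
  mdist (act g x0) (act (g * word_val u)%g x0) <= (size u)%:R * J.
Proof.
have [act1 actM actI] := isomA; move=> JP g u; rewrite actM actI.
elim: u => [|l u IHu]; first by rewrite word_val_nil act1 mdistxx mul0r.
rewrite word_val_cons actM.
have := metric_triangle x0 (act (letter_val l) x0)
  (act (letter_val l) (act (word_val u) x0)).
by rewrite actI /= -addn1 natrD; have := JP l; lra.
Qed.

(** The cyclically reduced conjugates of [w] are short, hence finitely many as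
    elements of [G]. A conjugator can be chosen for each of them, which makes
    the constants uniform although the given [h] is arbitrary. *)
Lemma root_power_dist (w : free_group S) (lam c0 : R) : 1 <= lam ->
  qi_embedding (fun m n : int => `|m - n|%:~R) (@mdist R X) lam c0
    (fun n => act (expgz (word_val w) n) x0) ->
  exists2 B : R, 0 <= B & forall h : free_group S,
    cyclically_reduced (w ^ h)%g -> forall k k', (k <= k')%N ->
    (k' - k)%:R <= lam * (mdist (act (word_val (w ^ h)%g ^+ k)%g x0)
      (act (word_val (w ^ h)%g ^+ k')%g x0) + B).
Proof.
move=> lam1 qi; have [act1 actM actI] := isomA.
pose Q (g : G) (n : nat) := (exists k, g = word_val w ^ k)%g ->
  exists2 k, (g = word_val w ^ k)%g & mdist x0 (act k x0) <= n%:R.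
have [||N NP] := @finite_uniform_bound G _ Q
  (finite_ball (size w) S_finite S_symmetric).
- move=> g _; have [[k gk]|nk] := EM (exists k, g = word_val w ^ k)%g; last first.
    by exists 0%N => ek.
  exists (Num.Def.archi_bound (mdist x0 (act k x0))) => _; exists k => //.
  by apply/ltW/archi_boundP/mdist_ge0.
- move=> g m n mn Qm /Qm [k gk km]; exists k => //; apply: le_trans km _.
  by rewrite ler_nat.
have c00 : 0 <= c0.
  have := qi 0 0; rewrite subrr normr0 mulr0 mdistxx; lra.
exists (N%:R * 2 + c0) => [|h cg k k' kk']; first by rewrite addr_ge0// mulr_ge0.
have [||a ga aN] := NP (word_val (w ^ h)%g).
- by exists (w ^ h)%g => //=; apply: size_cyclically_reduced_conj.
- by exists (word_val h); rewrite word_valJ.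
rewrite ga -!conjXg !conjgE !actM !actI.
have := qi (Posz k) (Posz k'); rewrite /= => /andP[+ _].
have -> : (`|Posz k - Posz k'|%:~R : R) = (k' - k)%:R.
  by rewrite distrC subzn.
set y := act _ x0; set y' := act _ x0; set z := act _ (act a x0).
set z' := act _ (act a x0).
have yz : mdist y z <= N%:R by rewrite actI.
have yz' : mdist y' z' <= N%:R by rewrite actI.
move=> lo; rewrite -ler_pdivrMl; last by lra.
have := metric_triangle y z y'; have := metric_triangle z z' y'.
by rewrite (metric_sym z' y'); lra.
Qed.

Lemma copy_quasigeodesic (w : free_group S) (lam0 c0 : R) : 1 <= lam0 ->
  qi_embedding (fun m n : int => `|m - n|%:~R) (@mdist R X) lam0 c0
    (fun n => act (expgz (word_val w) n) x0) ->
  exists lam c : R, [/\ 0 <= lam, 0 <= c & forall n (h : free_group S),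
    (0 < n)%N -> cyclically_reduced ((w ^+ n) ^ h)%g -> forall i j,
    (i <= j)%N -> (j <= size ((w ^+ n) ^ h)%g)%N ->
    (j - i)%:R <= lam * mdist
       (act (word_val (take i ((w ^+ n) ^ h)%g)) x0)
       (act (word_val (take j ((w ^+ n) ^ h)%g)) x0) + c].
Proof.
move=> lam1 qi; have [J J0 JP] := orbit_step.
have [B B0 BP] := root_power_dist lam1 qi.
pose W : R := (size w)%:R; have W0 : 0 <= W by apply: ler0n.
exists (W * lam0), (W * (lam0 * (2 * (W * J) + B) + 1)); split.
- by rewrite mulr_ge0//; lra.
- rewrite mulr_ge0// addr_ge0// mulr_ge0 ?addr_ge0 ?mulr_ge0//; lra.
move=> n h n0; rewrite conjXg => cu.
have [cg ->] := cyclically_reduced_root n0 cu.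
have sg := size_cyclically_reduced_conj cg.
have {BP} := BP h cg; set g := (w ^ h)%g in cg sg * => BP i j ij.
rewrite size_flatten /shape map_nseq sumn_nseq mulnC => jn.
have size_le k : (size (take k (word_of g)) <= size w)%N.
  by rewrite size_take_min; apply: leq_trans (geq_minr _ _) sg.
have near k : mdist (act (word_val g ^+ (k %/ size g))%g x0)
    (act (word_val (flatten (nseq (k %/ size g) (word_of g)) ++
       take (k %% size g) (word_of g))) x0) <= W * J.
  rewrite word_val_cat word_val_pow.
  apply: le_trans (orbit_word JP _ _) _.
  by rewrite ler_wpM2r// ler_nat.
rewrite !take_flatten_nseq//; last exact: leq_trans ij jn.
have kk : (i %/ size g <= j %/ size g)%N by apply: leq_div2r.
have {BP} := BP _ _ kk; have kj := near j; have := near i; move: kj.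
set z := act (_ ^+ (i %/ _))%g x0; set z' := act (_ ^+ (j %/ _))%g x0.
set y := act (word_val (_ (nseq (i %/ _) _) ++ _)) x0.
set y' := act (word_val (_ (nseq (j %/ _) _) ++ _)) x0 => kj ki BP.
have zz : mdist z z' <= mdist y y' + 2 * (W * J).
  have := metric_triangle z y z'; have := metric_triangle y y' z'.
  by rewrite (metric_sym y' z'); lra.
have jiW : (j - i)%:R <= W * ((j %/ size g - i %/ size g)%:R + 1).
  rewrite natr1 -natrM ler_nat.
  have [g0|g0] := posnP (size g).
    by move: jn ij; rewrite g0 muln0; clear; lia.
  apply: (@leq_trans (size g * (j %/ size g - i %/ size g).+1)%N).
    have := divn_eq i (size g); have := divn_eq j (size g).
    have := ltn_pmod j g0; move: kk; rewrite mulnS mulnBr ![(size g * _)%N]mulnC.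
    set a := (i %/ _)%N; set b := (j %/ _)%N => ab.
    have := leq_mul ab (leqnn (size g)); clear; lia.
  by rewrite leq_mul2r sg orbT.
apply: le_trans jiW _.
apply: (@le_trans _ _ (W * (lam0 * (mdist y y' + 2 * (W * J) + B) + 1))).
  rewrite ler_wpM2l// lerD2r; apply: le_trans BP _.
  by rewrite ler_wpM2l//; lra.
by rewrite le_eqVlt; apply/orP; left; apply/eqP; ring.
Qed.

End Orbits.

(** * Blocks deep inside a copy *)

Section DeepBlocks.
Variables (R : realType) (G : groupType) (S : set G) (X : metricType R).
Variables (act : G -> X -> X) (x0 : X) (delta : R).
Hypotheses (delta_gt0 : 0 < delta) (slimX : slim X delta).
Hypothesis geodX : forall x y : X, exists p, geodesic x y p.
Hypotheses (isomA : isometric_action act) (acyl : acylindrical act).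
Hypotheses (S_finite : finite_set S) (S_symmetric : symmetric_set S).
Hypothesis (S_generates : generates S).

Definition vertex (x : seq (letter S)) (t : nat) : G := word_val (take t x).

Lemma vertex_segment x s t : (s <= t)%N ->
  vertex x t = (vertex x s * word_val (take (t - s) (drop s x)))%g.
Proof. by move=> st; rewrite /vertex -word_val_cat -takeD subnKC. Qed.

Lemma vertex_ball x s t m : (s <= t <= s + m)%N -> exists2 u : seq (letter S),
  (size u <= m)%N & word_val u = ((vertex x s)^-1 * vertex x t)%g.
Proof.
case/andP=> st tm; exists (take (t - s) (drop s x)).
  by rewrite size_take_min; apply: leq_trans (geq_minl _ _) _; lia.
by rewrite (vertex_segment _ st) mulKg.
Qed.

Lemma vertex_dist (J : R) x s t : 0 <= J ->
  (forall l : letter S, mdist x0 (act (letter_val l) x0) <= J) ->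
  (s <= t)%N ->
  mdist (act (vertex x s) x0) (act (vertex x t) x0) <= (t - s)%:R * J.
Proof.
move=> J0 JP st; rewrite (vertex_segment x st).
apply: le_trans (orbit_word isomA JP _ _) _.
by rewrite ler_wpM2r// ler_nat size_take_min geq_minl.
Qed.

(** The lower half of the quasi-isometry condition, with the word metric
    replaced by the lengths of walks. *)
Definition tight_loop (mu cq : R) (x : seq (letter S)) : Prop :=
  forall s t n, (s < size x)%N -> (t < size x)%N ->
  (forall y, walk (cayley_edge S) n y
     (y * ((vertex x s)^-1 * vertex x t))%g) ->
  (cyc_dist (size x) s t)%:R <= mu * (n%:R + cq).

Definition quasigeodesic_at (lam c : R) (x : seq (letter S)) (i0 l : nat) :=
  (i0 + l <= size x)%N /\ forall i j, (i0 <= i)%N -> (i <= j)%N ->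
    (j <= i0 + l)%N ->
    (j - i)%:R <=
      lam * mdist (act (vertex x i) x0) (act (vertex x j) x0) + c.

(** Suppose that the geodesic of the block [k] fellow-travels that of another
    block [k'] for a long time. By [finite_fellows], the position of a vertex
    of the block [k] relative to the start of the block [k'] takes finitely
    many values, so that the two are at bounded distance in the Cayley graph,
    hence in the loop. If the block [k] is deep enough, both lie in the same
    quasi-geodesic, whose disjoint pieces can only be close near a common
    end. The bound [H0] is chosen before the length [m] of the blocks, on
    which only the depth [E] depends. *)
Lemma deep_block_alone (J lam c mu cq : R) : 0 <= J ->
  (forall l : letter S, mdist x0 (act (letter_val l) x0) <= J) ->
  0 <= lam -> 0 <= c -> 0 <= mu -> 0 <= cq ->
  exists H0 : R, forall m, exists E : nat, forall x i0 l k k' p1 p2 q1 q2,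
  tight_loop mu cq x -> quasigeodesic_at lam c x i0 l ->
  (i0 + E <= k * m)%N -> (k * m + m + E <= i0 + l)%N ->
  k' != k -> (k' * m < size x)%N ->
  let o t := act (vertex x t) x0 in
  btw (o (k * m)%N) (o (k * m + m)%N) p1 ->
  btw (o (k * m)%N) (o (k * m + m)%N) p2 ->
  btw (o (k' * m)%N) (o (minn (k' * m + m) (size x))) q1 ->
  btw (o (k' * m)%N) (o (minn (k' * m + m) (size x))) q2 ->
  mdist p1 q1 <= 3 * delta -> mdist p2 q2 <= 3 * delta ->
  mdist p1 p2 < H0.
Proof.
have d0 := delta_gt0; have [act1 actM actI] := isomA.
move=> J0 JP lam0 c0 mu0 cq0.
have [D D0 DP] := quasigeodesic_near delta_gt0 slimX geodX lam0 c0 J0.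
have r0 : 0 <= D + 3 * delta by lra.
have [M MP] := finite_fellows delta_gt0 slimX isomA acyl x0 r0.
pose C := lam * (2 * D + 3 * delta) + c.
have C0 : 0 <= C by rewrite addr_ge0// mulr_ge0//; lra.
exists (`|M| + 6 * delta + 2 * D + J * C + 1) => m.
pose ball := [set word_val u | u in [set u : seq (letter S) | (size u <= m)%N]].
pose F := \bigcup_(sigma in ball) \bigcup_(v in ball)
  [set u | exists q1 q2,
    [/\ btw x0 (act sigma x0) q1, btw x0 (act sigma x0) q2,
        mdist (act u x0) q1 <= D + 3 * delta,
        mdist (act (u * v)%g x0) q2 <= D + 3 * delta & M <= mdist q1 q2]].
have finF : finite_set F.
  have finB : finite_set ball by apply: finite_ball.
  by apply: bigcup_finite => // a _; apply: bigcup_finite.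
have [||N NP] := @finite_uniform_bound G F (fun u n => exists2 n', (n' <= n)%N &
    forall y, walk (cayley_edge S) n' y (y * u)%g) finF.
- by move=> u _; have [n nP] := cayley_walk S_symmetric S_generates u;
    exists n, n.
- by move=> u a b ab [n na nP]; exists n => //; apply: leq_trans ab.
pose B := Num.Def.archi_bound (mu * (N%:R + cq)).
have BP : mu * (N%:R + cq) < B%:R.
  by apply: archi_boundP; rewrite mulr_ge0// addr_ge0.
exists (B + m + 1)%N => x i0 l k k' p1 p2 q1 q2 tight [i0l qg] deep1 deep2 kk' k'L o.
move=> p1b p2b q1b q2b pq1 pq2; rewrite ltNge; apply/negP => far.
have step i : mdist (o i) (o i.+1) <= J.
  by have := vertex_dist x J0 JP (leqnSn i); rewrite subSnn mul1r.
have near_copy s t z : (i0 <= s)%N -> (s <= t)%N -> (t <= i0 + l)%N ->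
    btw (o s) (o t) z -> exists2 r, (s <= r <= t)%N & mdist z (o r) <= D.
  move=> s0 st tl; apply: DP => // i j si ij jt; apply: qg => //.
    exact: leq_trans s0 si.
  exact: leq_trans jt tl.
have JC : 0 <= J * C by rewrite mulr_ge0.
have M0 := normr_ge0 M; have MM := ler_norm M.
have [t1 t1k pt1] : exists2 r, (k * m <= r <= k * m + m)%N & mdist p1 (o r) <= D.
  by apply: near_copy p1b; move: deep1 deep2; clear; lia.
have [t2 t2k pt2] : exists2 r, (k * m <= r <= k * m + m)%N & mdist p2 (o r) <= D.
  by apply: near_copy p2b; move: deep1 deep2; clear; lia.
have q12 : M <= mdist q1 q2.
  have := metric_triangle p1 q1 p2; have := metric_triangle q1 q2 p2.
  by rewrite (metric_sym q2 p2); lra.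
(* Translate by the inverse [y^-1] of the start of the block [k'], so that its
   segment starts at [x0] and ends at one of finitely many points. *)
have close (s t : nat) (a b : X) : (k * m <= s)%N -> (s <= t)%N ->
    (t <= k * m + m)%N -> btw (o (k' * m)%N) (o (minn (k' * m + m) (size x))) a ->
    btw (o (k' * m)%N) (o (minn (k' * m + m) (size x))) b ->
    mdist (o s) a <= D + 3 * delta -> mdist (o t) b <= D + 3 * delta ->
    M <= mdist a b -> (cyc_dist (size x) (k' * m) s <= B)%N.
  move=> ks st tk ab bb sa tb Mab.
  pose y := vertex x (k' * m)%N.
  pose sigma := (y^-1 * vertex x (minn (k' * m + m) (size x)))%g.
  have actV (g h : G) : mdist (act (y^-1 * g)%g x0) (act y^-1%g (act h x0)) =
      mdist (act g x0) (act h x0) by rewrite actM actI.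
  have ysig : act sigma x0 = act y^-1%g (o (minn (k' * m + m) (size x))).
    by rewrite /sigma actM.
  have yx0 : x0 = act y^-1%g (o (k' * m)%N) by rewrite -actM mulVg act1.
  have trans z : btw (o (k' * m)%N) (o (minn (k' * m + m) (size x))) z ->
      btw x0 (act sigma x0) (act y^-1%g z).
    move=> bz; suff : btw (act y^-1%g (o (k' * m)%N))
      (act y^-1%g (o (minn (k' * m + m) (size x)))) (act y^-1%g z).
      by rewrite -yx0 -ysig.
    by rewrite /btw !actI.
  have : F (y^-1 * vertex x s)%g.
    exists sigma.
      have [|u um ue] := @vertex_ball x (k' * m)%N
        (minn (k' * m + m) (size x)) m; last by exists u.
      by move: k'L; clear; lia.
    exists ((vertex x s)^-1 * vertex x t)%g.
      have [|u um ue] := @vertex_ball x s t m; last by exists u.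
      by move: ks st tk; clear; lia.
    exists (act y^-1%g a), (act y^-1%g b); split; [exact: trans|exact: trans|..].
    - by rewrite actM actI.
    - by rewrite -mulgA mulVKg actM actI.
    - by rewrite actI.
  case/NP => n nN wn; rewrite -(ler_nat R); apply: le_trans (ltW BP).
  have := tight _ _ _ k'L _ wn => /(_ _)/le_trans; apply.
    by move: i0l deep2 tk st; clear; lia.
  by rewrite ler_wpM2l// lerD2r ler_nat.
have opq (a b q : X) : mdist a q <= 3 * delta -> mdist a b <= D ->
    mdist b q <= D + 3 * delta.
  by have := metric_triangle b a q; rewrite (metric_sym b a); lra.
have opq1 := opq _ _ _ pq1 pt1; have opq2 := opq _ _ _ pq2 pt2.
have [s sk cs] : exists2 s, (k * m <= s <= k * m + m)%N &
    (cyc_dist (size x) (k' * m) s <= B)%N.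
  case/andP: (t1k) => ? ?; case/andP: (t2k) => ? ?.
  have [t12|/ltnW t21] := leqP t1 t2.
    by exists t1 => //; apply: (close t1 t2 q1 q2).
  by exists t2 => //; apply: (close t2 t1 q2 q1) => //; rewrite metric_sym.
have [k'l k'r] : (i0 <= k' * m)%N /\ (k' * m + m <= i0 + l)%N.
  by move: cs sk deep1 deep2 i0l k'L; rewrite /cyc_dist; clear; lia.
have k'm : minn (k' * m + m) (size x) = (k' * m + m)%N.
  by move: k'r i0l; clear; lia.
rewrite k'm in q1b q2b.
have near_q q : btw (o (k' * m)%N) (o (k' * m + m)%N) q ->
    exists2 r, (k' * m <= r <= k' * m + m)%N & mdist q (o r) <= D.
  by apply: near_copy; rewrite ?leq_addr.
have [s1 s1k qs1] := near_q _ q1b; have [s2 s2k qs2] := near_q _ q2b.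
have ps (p q : X) t s' : mdist p q <= 3 * delta -> mdist p (o t) <= D ->
    mdist q (o s') <= D -> mdist (o t) (o s') <= 2 * D + 3 * delta.
  have := metric_triangle (o t) p (o s'); have := metric_triangle p q (o s').
  by rewrite (metric_sym (o t) p); lra.
have d1 := ps _ _ _ _ pq1 pt1 qs1; have d2 := ps _ _ _ _ pq2 pt2 qs2.
have gap i j : (i0 <= i)%N -> (i <= j)%N -> (j <= i0 + l)%N ->
    mdist (o i) (o j) <= 2 * D + 3 * delta -> (j - i)%:R <= C.
  move=> ii ij jl dij; apply: le_trans (qg _ _ ii ij jl) _.
  by rewrite lerD2r ler_wpM2l.
have t12 : mdist (o t1) (o t2) <= J * C.
  have bound a : (a <= maxn t1 t2 - minn t1 t2)%N ->
    ((maxn t1 t2 - minn t1 t2)%:R <= C) -> mdist (o t1) (o t2) <= J * C.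
    move=> _ aC; have [t12|/ltnW t21] := leqP t1 t2.
      apply: le_trans (vertex_dist x J0 JP t12) _.
      rewrite mulrC ler_wpM2l//; apply: le_trans aC.
      by rewrite ler_nat; move: t12; clear; lia.
    rewrite metric_sym; apply: le_trans (vertex_dist x J0 JP t21) _.
    rewrite mulrC ler_wpM2l//; apply: le_trans aC.
    by rewrite ler_nat; move: t21; clear; lia.
  apply: (bound 0%N) => //; case: (ltngtP k' k) kk' => // kk _.
    have km : (k' * m + m <= k * m)%N by rewrite addnC -mulSn leq_mul2r kk orbT.
    have g1 : (t1 - s1)%:R <= C.
      by apply: gap; rewrite 1?metric_sym//; move: km k'l s1k t1k deep2; clear; lia.
    have g2 : (t2 - s2)%:R <= C.
      by apply: gap; rewrite 1?metric_sym//; move: km k'l s2k t2k deep2; clear; lia.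
    have [t12|/ltnW t21] := leqP t1 t2.
      by apply: le_trans g2; rewrite ler_nat; move: km s1k s2k t1k t2k t12; clear; lia.
    by apply: le_trans g1; rewrite ler_nat; move: km s1k s2k t1k t2k t21; clear; lia.
  have km : (k * m + m <= k' * m)%N by rewrite addnC -mulSn leq_mul2r kk orbT.
  have g1 : (s1 - t1)%:R <= C.
    by apply: gap => //; move: km k'r s1k t1k deep1; clear; lia.
  have g2 : (s2 - t2)%:R <= C.
    by apply: gap => //; move: km k'r s2k t2k deep1; clear; lia.
  have [t12|/ltnW t21] := leqP t1 t2.
    by apply: le_trans g1; rewrite ler_nat; move: km s1k s2k t1k t2k t12; clear; lia.
  by apply: le_trans g2; rewrite ler_nat; move: km s1k s2k t1k t2k t21; clear; lia.
have := metric_triangle p1 (o t1) p2; have := metric_triangle (o t1) (o t2) p2.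
by rewrite (metric_sym (o t2) p2); lra.
Qed.

End DeepBlocks.

(** * Counting covered positions *)

Lemma count_blocks (P : pred nat) m N : (0 < m)%N ->
  count (fun t => P (t %/ m)%N) (iota 0 (N * m)) = (m * count P (iota 0 N))%N.
Proof.
move=> m0; elim: N => [|N IHN]; first by rewrite mul0n /= muln0.
rewrite mulSn addnC iotaD count_cat IHN -addn1 iotaD count_cat /= add0n.
have : count (fun t => P (t %/ m)%N) (iota (0 + N * m) m) =
    count (fun=> P N) (iota (0 + N * m) m).
  apply: eq_in_count => t; rewrite mem_iota add0n => /andP[lo hi].
  congr (P _); apply/eqP; rewrite eqn_leq leq_divRL// lo andbT -ltnS ltn_divLR//.
  by rewrite mulSn addnC.
rewrite add0n => ->; case: (P N).
  by rewrite count_predT size_iota; lia.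
by rewrite count_pred0; lia.
Qed.

Lemma count_shift_up (Q : pred nat) h L : (forall t, Q t -> (t < L)%N) ->
  (count (fun p => Q (p + h)%N) (iota 0 L) <= count Q (iota 0 L))%N.
Proof.
move=> QL.
have -> : count (fun p => Q (p + h)%N) (iota 0 L) = count Q (iota h L).
  by rewrite -[in RHS](addn0 h) iotaDl count_map; apply: eq_count => p /=;
    rewrite addnC.
have : (count Q (iota h L) <= count Q (iota 0 (h + L)))%N.
  by rewrite iotaD count_cat add0n leq_addl.
rewrite addnC iotaD count_cat add0n => /leq_trans; apply.
have /eqP -> : count Q (iota L h) == 0%N; last by rewrite addn0.
rewrite -leqn0 leqNgt -has_count; apply/hasPn => t; rewrite mem_iota => /andP[Lt _].
by apply/negP => /QL; rewrite ltnNge Lt.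
Qed.

Lemma count_shift_down (Q : pred nat) h L :
  (count (fun p => (h <= p)%N && Q (p - h)%N) (iota 0 L) <= count Q (iota 0 L))%N.
Proof.
have zero n : (n <= h)%N ->
    count (fun p => (h <= p)%N && Q (p - h)%N) (iota 0 n) = 0%N.
  move=> nh; apply/eqP; rewrite -leqn0 leqNgt -has_count; apply/hasPn => t.
  rewrite mem_iota add0n => /= tn; apply/negP => /andP[ht _].
  by move: (leq_trans tn nh); rewrite ltnNge ht.
have [Lh|/ltnW hL] := leqP L h; first by rewrite zero.
rewrite -[in X in (X <= _)%N](subnKC hL) iotaD count_cat zero// add0n add0n.
rewrite -[in X in (X <= _)%N](addn0 h) iotaDl count_map.
rewrite (@eq_count _ _ Q) => [|p /=]; last by rewrite addn0 leq_addr addKn.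
by rewrite addn0 -[in X in (_ <= X)%N](subnK hL) iotaD count_cat leq_addr.
Qed.

Section BlockPolygon.
Variables (R : realType) (X : metricType R) (delta H : R).
Hypotheses (delta_gt0 : 0 < delta) (slimX : slim X delta).
Hypothesis geodX : forall x y : X, exists p, geodesic x y p.
Hypothesis H_large : 20 * delta <= H.

(** Mark [kappa] points at distance [H] of each other on each side selected by
    [D], none on the other ones, and apply [polygon_marks]. *)
Lemma lonely_sides_few (o : nat -> X) (D : pred nat) (N kappa : nat) :
  (5 <= N)%N -> o N = o 0%N ->
  (forall k, (k < N)%N -> D k -> kappa%:R * H <= mdist (o k) (o k.+1)) ->
  (forall k k' p1 p2 q1 q2, (k < N)%N -> (k' < N)%N -> D k -> k' != k ->
     btw (o k) (o k.+1) p1 -> btw (o k) (o k.+1) p2 ->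
     btw (o k') (o k'.+1) q1 -> btw (o k') (o k'.+1) q2 ->
     mdist p1 q1 <= 3 * delta -> mdist p2 q2 <= 3 * delta ->
     mdist p1 p2 < H) ->
  (kappa * count D (iota 0 N) + 245 <= 61 * N)%N.
Proof.
have d0 := delta_gt0; have Hl := H_large.
move=> N5 closed long alone.
pose ms (k : nat) : seq R := if (k < N)%N && D k then
  [seq i%:R * H | i <- iota 0 kappa] else [::].
have : forall k, exists a : side X, [/\ src a = o k, tgt a = o k.+1,
    marks a = ms k & valid_side H a].
  move=> k; have [g [g0 g1 ig]] := geodX (o k) (o k.+1).
  exists (Side g 0 (mdist (o k) (o k.+1)) (ms k)); split=> //.
  split=> //=; first exact: mdist_ge0.
    rewrite /ms; case: ifP => // _; rewrite pairwise_map.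
    have : pairwise ltn (iota 0 kappa).
      by rewrite -(sorted_pairwise ltn_trans) iota_ltn_sorted.
    apply: sub_pairwise => i j /= ij.
    have : i.+1%:R <= j%:R :> R by rewrite ler_nat.
    rewrite -natr1 => le; have -> : i%:R * H + H = (i%:R + 1) * H by ring.
    by rewrite ler_wpM2r//; lra.
  rewrite /ms; case: ifP => // /andP[kN Dk]; apply/allP => u /mapP[i + ->].
  rewrite mem_iota add0n => /= ik; have kH := long k kN Dk.
  rewrite mulr_ge0//=; last by lra.
  apply: le_trans kH; rewrite ler_wpM2r//; first by lra.
  by rewrite ler_nat ltnW.
move=> /choice[sd sdP].
pose P := [seq sd k | k <- iota 0 N].
have sP : size P = N by rewrite size_map size_iota.
have nP : nmarks P = (kappa * count D (iota 0 N))%N.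
  have : {subset iota 0 N <= [pred k | k < N]%N}.
    by move=> k; rewrite mem_iota add0n.
  rewrite /P; elim: (iota 0 N) => [|k s IHs] sub; first by rewrite /= muln0.
  rewrite /= nmarks_cons IHs; last first.
    by move=> j js; apply: sub; rewrite inE js orbT.
  have kN : (k < N)%N by have := sub k (mem_head _ _).
  have [_ _ -> _] := sdP k; rewrite /ms kN /=; case: (D k).
    by rewrite size_map size_iota mulnDr muln1.
  by rewrite add0n.
have lon k k' : (k < N)%N -> (k' < N)%N -> k' != k ->
    lonely (3 * delta) (sd k) (sd k').
  move=> kN k'N kk' u v; have [sk tk mk vk] := sdP k.
  have [sk' tk' _ _] := sdP k'; rewrite sk' tk' => um vm.
  have Dk : D k by move: um; rewrite mk /ms kN /=; case: (D k).
  move=> [q1 q1b u1] [q2 q2b v2]; apply/eqP/negPn/negP => uv.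
  have := marks_gap vk um vm uv; rewrite leNgt => /negP; apply.
  have [_ isk _ _] := vk.
  have bu := marks_bounds vk um; have bv := marks_bounds vk vm.
  apply: (alone k k' _ _ q1 q2) => //; rewrite -sk -tk.
    by apply: (isom_btw isk); lra.
  by apply: (isom_btw isk); lra.
have polP : polygon H (3 * delta) P.
  split.
  - exists (o 0%N).
    suff ch n j : chain (o j) [seq sd k | k <- iota j n] (o (j + n)%N).
      by have := ch N 0%N; rewrite add0n closed.
    elim: n j => [|n IHn] j /=; first by rewrite addn0.
    have [-> -> _ _] := sdP j; split => //.
    by rewrite -addSnnS; apply: IHn.
  - rewrite all_map; apply/allP => k _ /=; apply/asboolP.
    by have [] := sdP k.
  - rewrite /P pairwise_map.
    have : uniq (iota 0 N) by apply: iota_uniq.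
    have : {subset iota 0 N <= [pred k | k < N]%N}.
      by move=> k; rewrite mem_iota add0n.
    elim: (iota 0 N) => //= k s IHs sub /andP[ks us].
    rewrite IHs// ?andbT; last by move=> j js; apply: sub; rewrite inE js orbT.
    have kN : (k < N)%N by have := sub k (mem_head _ _).
    apply/allP => j js; have jN : (j < N)%N.
      by have := sub j; rewrite inE js orbT => /(_ isT).
    have jk : j != k by apply: contraNneq ks => <-.
    by apply/asboolP; split; apply: lon => //; rewrite eq_sym.
have := polygon_marks delta_gt0 slimX geodX H_large polP.
by rewrite sP nP => /(_ N5).
Qed.

End BlockPolygon.

Section Saturation.
Variables (R : realType) (G : groupType) (S : set G) (X : metricType R).
Variables (act : G -> X -> X) (x0 : X) (delta : R).
Hypotheses (delta_gt0 : 0 < delta) (slimX : slim X delta).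
Hypothesis geodX : forall x y : X, exists p, geodesic x y p.
Hypotheses (isomA : isometric_action act) (acyl : acylindrical act).
Hypotheses (S_finite : finite_set S) (S_symmetric : symmetric_set S).
Hypothesis (S_generates : generates S).

(** A block deep inside a copy carries [kappa] marks as soon as [m] is large, so
    that there are few such blocks. Moving a covered position by [h] up or
    down, towards the middle of its copy, sends it into a deep block, so that
    the covered positions are at most [2 * m] times as many. *)
Lemma few_quasigeodesic_positions (lam c mu cq : R) :
  0 <= lam -> 0 <= c -> 0 <= mu -> 0 <= cq ->
  forall kappa : nat, exists n0 : nat,
  forall (x : seq (letter S)) (cov : pred nat),
  tight_loop mu cq x -> word_val x = 1%g ->
  (forall p, (p < size x)%N -> cov p -> exists i0 l,
     [/\ quasigeodesic_at act x0 lam c x i0 l, (i0 <= p < i0 + l)%N &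
         (n0 <= l)%N]) ->
  (kappa * count cov (iota 0 (size x)) <= 244 * size x)%N.
Proof.
have d0 := delta_gt0; have [J J0 JP] := orbit_step act x0 S_finite S_symmetric.
move=> lam0 c0 mu0 cq0 kappa.
have [H0 H0P] := deep_block_alone delta_gt0 slimX geodX isomA acyl S_finite
  S_symmetric S_generates J0 JP lam0 c0 mu0 cq0.
pose H := Num.max (20 * delta) H0.
have H20 : 20 * delta <= H by rewrite le_max lexx.
have HH0 : H0 <= H by rewrite le_max lexx orbT.
pose m := (Num.Def.archi_bound (lam * (kappa%:R * H) + c)).+1.
have mP : lam * (kappa%:R * H) + c < m%:R.
  apply: (@lt_trans _ _ (m.-1)%:R); last by rewrite ltr_nat.
  by apply: archi_boundP; rewrite addr_ge0// mulr_ge0// mulr_ge0//; lra.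
have m0 : (0 < m)%N by [].
have {H0P} [E EP] := H0P m; pose h := (E + m)%N.
exists (4 * h + 5 * m + 1)%N => x cov tight x1 covP; pose L := size x.
have [->|/eqP cov0] := eqVneq (count cov (iota 0 (size x))) 0%N.
  by rewrite muln0.
have L0 : (4 * h + 5 * m + 1 <= L)%N.
  have : has cov (iota 0 (size x)) by rewrite has_count; move: cov0; clear; lia.
  case/hasP => p; rewrite mem_iota add0n => /= pL /(covP p pL)[i0 [l [[i0l _] _ nl]]].
  by move: i0l nl; rewrite /L; clear; lia.
pose deep k := `[< exists i0 l, [/\ quasigeodesic_at act x0 lam c x i0 l,
  (i0 + E <= k * m)%N & (k * m + m + E <= i0 + l)%N] >].
pose N := ((L - 1) %/ m).+1.
have NmL : (L <= N * m)%N.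
  by have := ltn_ceil (L - 1) m0; move: L0; rewrite /N; clear; lia.
have NmU : ((N - 1) * m <= L - 1)%N.
  by rewrite /N subSS subn0 leq_divM.
have N5 : (5 <= N)%N.
  by rewrite ltnS leq_divRL//; move: L0; clear; lia.
have few : (kappa * count deep (iota 0 N) + 245 <= 61 * N)%N.
  have kL k : (k < N)%N -> (k * m < size x)%N.
    move=> kN; apply: (@leq_ltn_trans ((N - 1) * m)).
      by rewrite leq_mul2r; apply/orP; right; move: kN; clear; lia.
    by move: NmU L0; rewrite /L; clear; lia.
  have vmin t : vertex x (minn t (size x)) = vertex x t.
    rewrite /vertex; case: leqP => // xt.
    by rewrite !take_oversize// ltnW.
  apply: (lonely_sides_few delta_gt0 slimX geodX H20 (o := fun k =>
    act (vertex x (k * m)%N) x0)) => //.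
  - by rewrite mul0n /vertex take0 word_val_nil take_oversize// x1.
  - move=> k kN /asboolP[i0 [l [[i0l qg] deep1 deep2]]].
    rewrite (mulSn k) (addnC m); have := qg (k * m)%N (k * m + m)%N.
    rewrite addKn leq_addr => qgk.
    have {qgk} : m%:R <= lam * mdist (act (vertex x (k * m)%N) x0)
        (act (vertex x (k * m + m)%N) x0) + c.
      by apply: qgk => //; move: deep1 deep2; clear; lia.
    move=> qgk; rewrite leNgt; apply/negP => /ltW far.
    by have := ler_wpM2l lam0 far; lra.
  - move=> k k' p1 p2 q1 q2 kN k'N /asboolP[i0 [l [qg deep1 deep2]]] kk'.
    rewrite !mulSn ![(m + _)%N]addnC -(vmin (k' * m + m)%N).
    move=> b1 b2 b1' b2' pq1 pq2; apply: lt_le_trans HH0.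
    exact: (EP x i0 l k k' p1 p2 q1 q2 tight qg deep1 deep2 kk' (kL k' k'N)).
pose Dp t := (t < L)%N && deep (t %/ m)%N.
have le1 : (count Dp (iota 0 L) <= m * count deep (iota 0 N))%N.
  rewrite -count_blocks// -(subnKC NmL) iotaD count_cat.
  apply: leq_trans (leq_addr _ _).
  by apply: sub_count => t /andP[].
have le2 : (count cov (iota 0 L) <= 2 * count Dp (iota 0 L))%N.
  pose up p := Dp (p + h)%N; pose dn p := (h <= p)%N && Dp (p - h)%N.
  have sub p : (p < L)%N && cov p -> predU up dn p.
    case/andP=> pL /(covP p pL)[i0 [l [qg /andP[ip pi] nl]]].
    have i0l := qg.1; have := divn_eq (p + h) m; have := ltn_pmod (p + h) m0.
    have := divn_eq (p - h) m; have := ltn_pmod (p - h) m0.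
    have [low|high] := ltnP p (i0 + 2 * h).
      move=> _ _ r1 r2; apply/orP; left; apply/andP; split.
        by move: low nl i0l; rewrite /L; clear; lia.
      apply/asboolP; exists i0, l; split => //.
        by move: r1 r2 ip; rewrite /h; clear; lia.
      by move: r1 r2 low nl; rewrite /h; clear; lia.
    move=> r1 r2 _ _; apply/orP; right; apply/and3P; split.
    - by move: high; clear; lia.
    - by move: pL; clear; lia.
    - apply/asboolP; exists i0, l; split => //.
        by move: r1 r2 high; rewrite /h; clear; lia.
      by move: r1 r2 pi high; rewrite /h; clear; lia.
  have -> : count cov (iota 0 L) = count (fun p => (p < L)%N && cov p) (iota 0 L).
    by apply: eq_in_count => p; rewrite mem_iota add0n => /= ->.
  apply: leq_trans (sub_count sub _) _.
  rewrite mul2n -addnn; apply: (@leq_trans (count up (iota 0 L) + count dn (iota 0 L))).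
    by rewrite -count_predUI leq_addr.
  by apply: leq_add; [apply: count_shift_up => t /andP[]|apply: count_shift_down].
have Nm2 : (N * m <= 2 * L)%N.
  move: NmU L0 N5; case: (N) => // N'; rewrite subSS subn0 mulSn; clear; lia.
rewrite -/L; apply: (@leq_trans (122 * (N * m))).
  apply: (@leq_trans (kappa * (2 * (m * count deep (iota 0 N))))).
    by rewrite leq_mul2l; apply/orP; right; move: le1 le2; clear; lia.
  have -> : (kappa * (2 * (m * count deep (iota 0 N))) =
    2 * m * (kappa * count deep (iota 0 N)))%N by ring.
  apply: (@leq_trans (2 * m * (61 * N))%N).
    by rewrite leq_mul2l; apply/orP; right; move: few; clear; lia.
  by apply/eq_leq; ring.
by move: Nm2; clear; lia.
Qed.

End Saturation.

(** * The theorem *)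

Lemma card_ord_count (n : nat) (P : pred nat) :
  #|[pred p : 'I_n | P p]| = count P (iota 0 n).
Proof.
rewrite -val_enum_ord count_map enumT cardE /enum_mem size_filter.
by apply: eq_count => p.
Qed.

(** The limit of a divergent sequence is 0 by convention. *)
Lemma lim_le_bound (R : realType) (u : nat -> R) (b : R) : 0 <= b ->
  (exists n0, forall n, (n0 <= n)%N -> u n <= b) -> limn u <= b.
Proof.
move=> b0 [n0 ub]; have [cu|/dvgP ->] := EM (cvgn u); last exact: b0.
by apply: limr_le => //; exists n0 => // n /= /ub.
Qed.

Lemma covered_quasigeodesic (R : realType) (G : groupType) (S : set G)
    (X : metricType R) (act : G -> X -> X) (x0 : X) (w : free_group S)
    (lam c : R) n (x : seq (letter S)) p :
  isometric_action act -> (0 < n)%N ->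
  (forall n (h : free_group S),
    (0 < n)%N -> cyclically_reduced ((w ^+ n) ^ h)%g -> forall i j,
    (i <= j)%N -> (j <= size ((w ^+ n) ^ h)%g)%N ->
    (j - i)%:R <= lam * mdist
       (act (word_val (take i ((w ^+ n) ^ h)%g)) x0)
       (act (word_val (take j ((w ^+ n) ^ h)%g)) x0) + c) ->
  (p < size x)%N -> covered (w ^+ n)%g x p -> exists i0 l,
  [/\ quasigeodesic_at act x0 lam c x i0 l, (i0 <= p < i0 + l)%N & (n <= l)%N].
Proof.
move=> [act1 actM actI] n0 qg px [h [i0 [cu pre ip]]].
set u := ((w ^+ n) ^ h)%g in cu pre ip; have [s xs] := prefixP pre.
exists i0, (size u); split=> //.
  split.
    have : size (drop i0 x) = (size u + size s)%N by rewrite xs size_cat.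
    by rewrite size_drop; move: ip; clear; lia.
  move=> i j i0i ij ji.
  have vE t : (i0 <= t)%N -> (t <= i0 + size u)%N ->
      vertex x t = (vertex x i0 * word_val (take (t - i0) u))%g.
    move=> it ti; rewrite (vertex_segment x it) xs takel_cat//.
    by rewrite leq_subLR.
  rewrite (vE i) ?(vE j); try by move: i0i ij ji; clear; lia.
  rewrite !actM actI.
  have := qg n h n0 cu (i - i0)%N (j - i0)%N.
  have -> : (j - i0 - (i - i0) = j - i)%N by move: i0i ij; clear; lia.
  by apply; [apply: leq_sub2r|rewrite leq_subLR].
have g0 : (0 < size u)%N by move: ip; clear; lia.
move: g0 cu; rewrite /u conjXg => g0 cu.
have [_ uE] := cyclically_reduced_root n0 cu.
move: g0; rewrite uE size_flatten /shape map_nseq sumn_nseq muln_gt0 => /andP[g0 _].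
exact: leq_pmull.
Qed.

Theorem theorem1p3 (R : realType) (G : groupType) (S : set G)
    (S_finite : finite_set S) (S_symmetric : symmetric_set S)
    (S_generates : generates S)
    (w : free_group S) (v : nat -> free_group S)
    (v_cyclically_reduced : forall i, cyclically_reduced (v i))
    (v_trivial : forall i, word_val (v i) = 1%g)
    (v_quasi_isometric : exists mu c : R, [/\ 1 <= mu, 0 <= c &
       forall i, qi_embedding (path_metric R (@cycle_edge (size (v i))))
         (path_metric R (cayley_edge S)) mu c (@cayley_loop G S (v i))])
    (sat_limit : 0 < limn (fun n => limn_sup (fun i => sat R (w ^+ n)%g (v i)))) :
  ~ generalized_loxodromic R (word_val w).
Proof.
case=> X [act [hypX isomA acyl [x0 [lam0 [c0 [lam1 c00 qiw]]]]]].
have [delta delta_gt0 slimX] := hyperbolic_slim hypX.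
have [geodX _] := hypX.
have [lam [c [lam_ge0 c_ge0 qg]]] :=
  copy_quasigeodesic isomA S_finite S_symmetric lam1 qiw.
have [mu [cq [mu1 cq0 qiv]]] := v_quasi_isometric.
have mu0 : 0 <= mu by lra.
have few := few_quasigeodesic_positions x0 delta_gt0 slimX geodX isomA
  acyl S_finite S_symmetric S_generates lam_ge0 c_ge0 mu0 cq0.
have sat_small (kappa : nat) : (0 < kappa)%N -> exists n0, forall n, (n0 <= n)%N ->
    forall i, sat R (w ^+ n)%g (v i) <= 244 / kappa%:R.
  move=> k0; have [n0 n0P] := few kappa; exists n0.+1 => n nn0 i.
  have kR : 0 < kappa%:R :> R by rewrite ltr0n.
  rewrite /sat; set L := size (v i).
  have [->|L0] := posnP L; first by rewrite invr0 mulr0 divr_ge0// ler0n.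
  rewrite ler_pdivrMr ?ltr0n// mulrAC ler_pdivlMr// -natrM -natrM ler_nat.
  rewrite -leq_divRL//; apply/bigmax_leqP => -[j jL] _.
  rewrite leq_divRL// mulnC [nat_of_ord _]/= (card_ord_count _ (fun p =>
    `[< covered (w ^+ n)%g (rot j (v i)) p >])).
  rewrite /L -(size_rot j (v i)); apply: n0P.
  - move=> s t k; rewrite size_rot => sL tL.
    apply: (loop_cyc_dist _ (v_trivial i) (qiv i)) => //; lra.
  - by rewrite /rot word_val_cat; apply/eqP; rewrite mulg_eq1; apply/eqP;
      apply: (@mulgI _ (word_val (take j (v i)))); rewrite -word_val_cat cat_take_drop v_trivial mulgV.
  - move=> p; rewrite size_rot => pL /asboolP cp.
    have [||i0 [l [ql il nl]]] := covered_quasigeodesic isomA _ qg _ cp.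
    + by move: nn0; clear; lia.
    + by rewrite size_rot.
    by exists i0, l; split => //; move: nl nn0; clear; lia.
have lim_small (kappa : nat) : (0 < kappa)%N ->
    limn (fun n => limn_sup (fun i => sat R (w ^+ n)%g (v i))) <= 244 / kappa%:R.
  move=> k0; have b0 : 0 <= 244 / kappa%:R :> R by rewrite divr_ge0// ler0n.
  apply: lim_le_bound => //; have [n0 n0P] := sat_small kappa k0; exists n0 => n nn0.
  apply: lim_le_bound => //; exists 0%N => k _.
  apply: ge_sup; last by move=> _ [i _ <-]; apply: n0P.
  by exists (sat R (w ^+ n)%g (v k)), k => //=.
move: sat_limit; set l := limn _ => l0.
pose k := (Num.Def.archi_bound (244 / l)).+1.
have := lim_small k isT; rewrite -/l leNgt => /negP; apply.
rewrite ltr_pdivrMr ?ltr0n// mulrC -ltr_pdivrMr//.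
apply: (@lt_trans _ _ (k.-1)%:R); last by rewrite ltr_nat.
by apply: archi_boundP; rewrite divr_ge0// ltW.
Qed.
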